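(* Assume $h\ge 0$. Let $\mathcal A$ be a maximal abelian subgroup of $P$. For any subgroup $A\subset\mathcal A$ of order $p^h$ that intersects the center $Z(P)$ of $P$ trivially, the quotient curve $\overline C_A=C_R/A$ is isomorphic over $\mathbb{F}_q$ to the smooth projective curve given by the affine equation $$Y^p-Y=a_{\mathcal A}X^2,$$ where $$a_{\mathcal A}=\frac{a_h}{2}\prod_{c\in\overline A\setminus\{0\}}c\quad\text{for } h\ge 1,\qquad a_{\mathcal A}=a_0\quad\text{for } h=0,$$ with $a_h$ the leading coefficient of $R$ and $\overline A\subseteq W$ the image of $\mathcal A$ under the map $P\to W$, $\sigma_{b,c}\mapsto c$.
   Context: Let $p$ be an odd prime, $k=\overline{\mathbb{F}}_p$, $h\ge 0$, and $R(X)=\sum_{i=0}^h a_iX^{p^i}\in\mathbb{F}_{p^r}[X]$ with $a_h\neq 0$ (an additive polynomial of degree $p^h$). $C_R$ is the smooth projective absolutely irreducible curve over $\mathbb{F}_{p^r}$ with affine equation $Y^p-Y=XR(X)$; it has a unique point $\infty$ at infinity. Put $E(X)=R(X)^{p^h}+\sum_{i=0}^h (a_iX)^{p^{h-i}}\in\mathbb{F}_{p^r}[X]$, $W=\{c\in k: E(c)=0\}$ (an $\mathbb{F}_p$-vector space of dimension $2h$), and let $\mathbb{F}_q\supseteq\mathbb{F}_{p^r}$ be the splitting field of $E$ over $\mathbb{F}_{p^r}$. For $c\in W$ let $B_c(X)\in Xk[X]$ be the unique polynomial with zero constant term satisfying $B_c(X)^p-B_c(X)=cR(X)+R(c)X$.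 For $c\in W$ and $b\in k$ with $b^p-b=cR(c)$, let $\sigma_{b,c}$ be the automorphism $(x,y)\mapsto(x+c,\,y+b+B_c(x))$ of $C_R$. $P$ is the group of all such $\sigma_{b,c}$; it is the unique Sylow $p$-subgroup of the group of $k$-automorphisms of $C_R$ fixing $\infty$, and all its elements are defined over $\mathbb{F}_q$, so that quotients of $C_R$ by subgroups of $P$ are defined over $\mathbb{F}_q$. The center $Z(P)$ is generated by $\rho:(x,y)\mapsto(x,y+1)$. For $h\ge1$, the set $\overline A$ is a maximal isotropic subspace of $W$ for the symplectic pairing $\epsilon(c_1,c_2)=B_{c_1}(c_2)-B_{c_2}(c_1)\in\mathbb{F}_p$. *)

(* Defs.v *)
(* Smooth projective curves over a perfect field are handled through their
   function fields: the curve with affine equation Y^p - Y = g(X) is given by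
   its function field, an isomorphism of curves over F is an isomorphism of
   function fields over F, and the quotient of a curve by a finite group of
   automorphisms is the curve whose function field is the field of
   invariants. *)
From mathcomp Require Import all_boot all_order all_algebra all_field.
From mathcomp Require Import all_classical.

Set Implicit Arguments.
Unset Strict Implicit.
Unset Printing Implicit Defensive.

Import GRing.Theory.
Local Open Scope classical_set_scope.
Local Open Scope ring_scope.

(* The subfield F(x, y) of L. *)
Definition adjoin2 (F L : fieldType) (i : {rmorphism F -> L}) (x y : L) :
    set L :=
  [set z | forall S : {pred L}, divring_closed S ->
             (forall t, i t \in S) -> x \in S -> y \in S -> z \in S].

(* (L, x, y) is the function field over F of Y^p - Y = g(X), with x and y the
   coordinate functions. When this equation is irreducible over F(X), in
   particular when F has characteristic p and p does not divide deg g, these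
   conditions determine (L, x, y) up to a unique isomorphism over F. *)
Definition AS_function_field (p : nat) (F L : fieldType)
    (i : {rmorphism F -> L}) (g : {poly F}) (x y : L) : Prop :=
  [/\ ~ algebraicOver i x,
      y ^+ p - y = (map_poly i g).[x] &
      adjoin2 i x y = setT].

Lemma irreducible_factor (F : fieldType) (f : {poly F}) :
  (1 < size f)%N -> exists2 q : {poly F}, irreducible_poly q & q %| f.
Proof.
have [n] := ubnP (size f); elim: n f => // n IHn f ltfn f_gt1.
have [irr|nirr] := pselect (irreducible_poly f); first by exists f.
have [d [d_neq1 dvd_df ndf]] :
    exists d : {poly F}, [/\ size d != 1%N, d %| f & ~~ (d %= f)].
  apply: contrapT => nex; apply: nirr; split=> // d d_neq1 dvd_df.
  by apply: contrapT => /negP ndf; apply: nex; exists d.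
have f0 : f != 0 by rewrite -size_poly_gt0 ltnW.
have d_gt1 : (1 < size d)%N.
  by rewrite ltn_neqAle eq_sym d_neq1 size_poly_gt0 (dvdpN0 dvd_df).
have lt_df : (size d < size f)%N.
  by rewrite ltn_neqAle dvdp_leq // andbT dvdp_size_eqp.
have [q irr_q dvd_qd] := IHn d (leq_trans lt_df ltfn) d_gt1.
by exists q => //; apply: dvdp_trans dvd_df.
Qed.

Lemma tofrac_div (R : idomainType) (c : {fraction R}) :
  exists b d : R, d != 0 /\ c * tofrac d = tofrac b.
Proof.
elim/quotW: c => c; exists \n_c, \d_c; split; first exact: denom_ratioP.
unlock FracField.tofrac; apply/eqP.
rewrite [_ * _]piE; apply/eqP/eqmodP.
rewrite /= FracField.equivfE /FracField.mulf.
rewrite !numden_Ratio ?mulf_neq0 ?oner_neq0 ?denom_ratioP //.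
by rewrite !mulr1 mulrC.
Qed.

Lemma AS_function_field_exists (p : nat) (F : fieldType) (g : {poly F}) :
  (1 < p)%N ->
  exists (L : fieldType) (i : {rmorphism F -> L}) (x y : L),
    AS_function_field p i g x y.
Proof.
move=> p_gt1; pose K := {fraction {poly F}}.
pose i0 : {rmorphism F -> K} := @tofrac {poly F} \o polyC.
have i0E (q : {poly F}) : (map_poly i0 q).[tofrac 'X] = tofrac q.
  rewrite map_poly_comp horner_map /=; congr (tofrac _).
  by rewrite -/(comp_poly 'X q) comp_polyXr.
pose f : {poly K} := 'X^p - 'X - (tofrac g)%:P.
have size_f : size f = p.+1.
  rewrite /f -addrA size_polyDl size_polyXn // -opprD size_polyN ltnS.
  by rewrite size_XaddC.
have [|q irr_q dvd_qf] := @irreducible_factor _ f; first by rewrite size_f ltnW.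
have [L _ [y qy0 genL]] := irredp_FAdjoin irr_q.
have fy0 : root (map_poly (in_alg L) f) y.
  by rewrite (root_dvdp _ qy0) ?dvdp_map.
exists L, (in_alg L \o i0), (in_alg L (tofrac 'X)), y; split.
- case=> r r0; rewrite /root map_poly_comp horner_map i0E /=.
  by rewrite scaler_eq0 oner_eq0 orbF tofrac_eq0 (negPf r0).
- apply/eqP; rewrite map_poly_comp horner_map i0E -subr_eq0.
  move: fy0; rewrite /root /f !rmorphB /= map_polyXn map_polyX map_polyC.
  by rewrite !hornerE.
- apply/seteqP; split=> // w _ S Sdiv SF Sx Sy.
  have [_ SB SM] := GRing.divring_closedBM Sdiv.
  have [S1 _ Sdv] := Sdiv.
  have S0 : 0 \in S by rewrite -(subrr 1) SB.
  have SD b c : b \in S -> c \in S -> b + c \in S.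
    by move=> Sb Sc; rewrite -[c]opprK SB // -sub0r SB.
  have Shorner (r : {poly L}) t :
      (forall m, r`_m \in S) -> t \in S -> r.[t] \in S.
    move=> Sr St; rewrite horner_coef.
    apply: (big_ind (fun b => b \in S)) => // m _; rewrite SM //.
    by elim: (m : nat) => [|n IHn]; rewrite ?expr0 // exprS SM.
  have Stofrac (r : {poly F}) : in_alg L (tofrac r) \in S.
    rewrite -i0E -horner_map -map_poly_comp; apply: Shorner => // m.
    by rewrite coef_map; apply: SF.
  have : w \in <<1; y>>%VS by rewrite genL memvf.
  case/Fadjoin_polyP=> r r1 ->; apply: Shorner => // m.
  have /vlineP [c ->] := polyOverP r1 m.
  have [b [d [d0 cdb]]] := tofrac_div c.
  have -> : c = tofrac b / tofrac d by rewrite -cdb mulfK ?tofrac_eq0.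
  have := fmorph_div (in_alg L) (tofrac b) (tofrac d).
  by rewrite /= => ->; apply: Sdv; apply: Stofrac.
Qed.

(* Field morphisms being injective, [curve_iso_onto j i M] says that K is
   isomorphic over F to the subfield M of L. *)
Definition curve_iso_onto (F K L : fieldType) (j : {rmorphism F -> K})
    (i : {rmorphism F -> L}) (M : set L) : Prop :=
  exists2 phi : {rmorphism K -> L},
    (forall t, phi (j t) = i t) & range phi = M.

Section Groups.
Variable L : Type.
Implicit Types G H : set (L -> L).

Definition is_subgroup H G : Prop :=
  [/\ H `<=` G, H id, (forall s t, H s -> H t -> H (s \o t)) &
      forall s, H s -> exists2 t, H t & t \o s = id].

Definition is_abelian H : Prop :=
  forall s t, H s -> H t -> s \o t = t \o s.

Definition is_max_abelian H G : Prop :=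
  [/\ is_subgroup H G, is_abelian H &
      forall H', is_subgroup H' G -> is_abelian H' -> H `<=` H' -> H' = H].

Definition center G : set (L -> L) :=
  [set s | G s /\ forall t, G t -> s \o t = t \o s].

Definition invariants H (M : set L) : set L :=
  [set z | M z /\ forall s, H s -> s z = z].

End Groups.

Definition polyR (p h : nat) (F : fieldType) (a : 'I_h.+1 -> F) : {poly F} :=
  \sum_(i < h.+1) a i *: 'X^(p ^ i).

Definition polyE (p h : nat) (F : fieldType) (a : 'I_h.+1 -> F) : {poly F} :=
  polyR p a ^+ (p ^ h) + \sum_(i < h.+1) (a i *: 'X) ^+ (p ^ (h - i)).

Section GroupP.
Variables (p h : nat) (k L : fieldType) (a : 'I_h.+1 -> k).
Variables (i : {rmorphism k -> L}) (x y : L).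

Let R := polyR p a.

Definition setW : set k := [set c | root (polyE p a) c].

Definition isB (c : k) (B : {poly k}) : Prop :=
  B`_0 = 0 /\ B ^+ p - B = c *: R + R.[c] *: 'X.

Definition is_automorphism (s : L -> L) : Prop :=
  [/\ bijective s, zmod_morphism s, monoid_morphism s & s \o i =1 i].

(* A curve automorphism is represented by its pull-back on functions. As
   pull-back reverses composition, the groups below are the opposites of the
   groups of curve automorphisms; this affects neither subgroups,
   commutativity, centers, orders nor invariants. *)
Definition is_sigma (b c : k) (s : L -> L) : Prop :=
  [/\ is_automorphism s, s x = x + i c &
      exists2 B, isB c B & s y = y + i b + (map_poly i B).[x]].

Definition groupP : set (L -> L) :=
  [set s | exists b c, [/\ setW c, b ^+ p - b = c * R.[c] & is_sigma b c s]].

Definition imageW (H : set (L -> L)) : set k :=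
  [set c | setW c /\ exists b s, H s /\ is_sigma b c s].

Definition coefA (H : set (L -> L)) : k :=
  if h == 0 then a ord0
  else a ord_max / 2 * \big[*%R/1]_(c \in imageW H `\ 0) c.

End GroupP.

(* Main.v *)
(* Write V for the set of c with sigma_(b,c) in A, n = p^h = #|V|, f =
   prod_(c in V) (X - c), which is additive and generates the ring of
   V-invariant polynomials, and t for its derivative, a constant equal to the
   product of the nonzero elements of V. All elements of P are defined over
   F_q, so one can work there. The polynomials y^s - y (s in A) form an
   additive cocycle of V, hence a coboundary, which gives q with y + q(x)
   invariant under A. Then X R(X) + q^p - q = G(f), and modulo Artin-Schreier
   the degree of G can be taken prime to p; differentiating, it is 2 with
   leading coefficient al = a_h / (2 t) (for h > 0). Since X R(X) is even and
   f is odd, the linear term can be analysed separately: completing the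
   square leaves a constant of the form z^p - z with z in F_q. Rescaling f by
   t gives the coefficient al t^2. An element of P commuting with A has its c
   in V, by a degree argument on the quotient curve, so V is the image of the
   maximal abelian group. Finally F_q(x,y)^A is generated by f(x) and y +
   q(x) because F_q(x, y) is generated by x, of degree at most n, over the
   field they generate. *)
From HB Require Import structures.
Require Import Defs.
From mathcomp Require Import all_boot all_order all_algebra all_field.
From mathcomp Require Import all_classical.
From mathcomp Require Import zify ring.

Set Implicit Arguments.
Unset Strict Implicit.
Unset Printing Implicit Defensive.

Import GRing.Theory.
Local Open Scope classical_set_scope.
Local Open Scope ring_scope.

(** * Translation by a finite additive group *)

(** A finite additive subgroup as a list; opposites follow from finiteness, see [additive_seqN]. *)
Definition additive_seq (K : zmodType) (V : seq K) : Prop :=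
  [/\ uniq V, 0 \in V & forall c d, c \in V -> d \in V -> c + d \in V].

Section Translations.
Variable K : fieldType.
Implicit Types (p q g : {poly K}) (c d : K) (V : seq K).

Definition translate c : {poly K} -> {poly K} := comp_poly ('X + c%:P).

Lemma translateE c p d : (translate c p).[d] = p.[d + c].
Proof. by rewrite horner_comp !hornerE. Qed.

HB.instance Definition _ c :=
  GRing.RMorphism.copy (translate c) (comp_poly ('X + c%:P)).

Lemma translateC c d : translate c d%:P = d%:P.
Proof. exact: comp_polyC. Qed.

Lemma translateX c : translate c 'X = 'X + c%:P.
Proof. exact: comp_polyX. Qed.

Lemma translateD c d p : translate c (translate d p) = translate (c + d) p.
Proof. by rewrite /translate -comp_polyA comp_polyD comp_polyX comp_polyC
  polyCD addrA. Qed.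

Lemma translate0 p : translate 0 p = p.
Proof. by rewrite /translate addr0 comp_polyXr. Qed.

Lemma size_translate c p : size (translate c p) = size p.
Proof. by rewrite size_comp_poly2 // size_XaddC. Qed.

Definition annihilator V : {poly K} := \prod_(c <- V) ('X - c%:P).

Definition nonzeros V := [seq c <- V | c != 0].

Lemma size_annihilator V : size (annihilator V) = (size V).+1.
Proof. exact: size_prod_XsubC. Qed.

Lemma annihilator_monic V : annihilator V \is monic.
Proof. exact: monic_prod_XsubC. Qed.

Lemma root_annihilator V c : root (annihilator V) c = (c \in V).
Proof. exact: root_prod_XsubC. Qed.

Variable V : seq K.

(** Translation by [c] is injective and maps [V] to itself, so it permutes [V] by counting. *)
Lemma additive_seq_shift c : additive_seq V -> c \in V ->
  perm_eq [seq d + c | d <- V] V.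
Proof.
case=> uV V0 VD Vc.
have uVc : uniq [seq d + c | d <- V] by rewrite map_inj_uniq //; apply: addIr.
have sub : {subset [seq d + c | d <- V] <= V}.
  by move=> _ /mapP[d Vd ->]; apply: VD.
have [|_ eqV] := uniq_min_size uVc sub; first by rewrite size_map.
exact: uniq_perm.
Qed.

Lemma additive_seqN c : additive_seq V -> c \in V -> - c \in V.
Proof.
move=> aV Vc; have [_ V0 _] := aV.
move: V0; rewrite -(perm_mem (additive_seq_shift aV Vc)) => /mapP[d Vd] /eqP.
by rewrite eq_sym addr_eq0 => /eqP <-.
Qed.

Lemma translate_annihilator c : additive_seq V -> c \in V ->
  translate c (annihilator V) = annihilator V.
Proof.
move=> aV Vc; rewrite /annihilator rmorph_prod /=.
rewrite -[RHS](perm_big _ (additive_seq_shift aV (additive_seqN aV Vc)))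
  big_map.
apply: eq_bigr => d _; rewrite rmorphB /= translateX translateC.
by rewrite polyCB opprB addrA.
Qed.

Definition invariant_poly p := forall c, c \in V -> translate c p = p.

Lemma invariant_sub0 p : additive_seq V -> invariant_poly p ->
  all (root (p - (p.[0])%:P)) V.
Proof.
move=> aV ip; apply/allP => c Vc.
by rewrite /root !hornerE -{1}[c]add0r -translateE ip // subrr.
Qed.

(** [p - p(0)] vanishes on all of [V], which is more roots than its degree allows. *)
Lemma invariant_const p : additive_seq V -> invariant_poly p ->
  (size p <= size V)%N -> p = (p.[0])%:P.
Proof.
move=> aV ip sp; apply/eqP; rewrite -subr_eq0; apply/eqP.
have [uV V0 _] := aV.
apply: roots_geq_poly_eq0 uV _; first exact: invariant_sub0.
apply: leq_trans (size_polyD _ _) _; rewrite size_polyN geq_max sp.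
by apply: leq_trans (size_polyC_leq1 _) _; case: (V) V0.
Qed.

(** Induction on the degree: [p - p(0)] vanishes on [V], so the annihilator divides it, and the
    quotient is again invariant. *)
Lemma invariant_polyE p : additive_seq V -> invariant_poly p ->
  exists g, p = g \Po annihilator V.
Proof.
move=> aV; have [n] := ubnP (size p); elim: n p => // n IHn p sp ip.
have [uV V0 _] := aV.
have [sp1|sp1] := leqP (size p) 1.
  exists (p.[0])%:P; rewrite comp_polyC; apply: invariant_const => //.
  by apply: leq_trans sp1 _; case: (V) V0.
have := invariant_sub0 aV ip.
move/uniq_roots_prod_XsubC => -[|q pq]; first by rewrite uniq_rootsE.
rewrite -/(annihilator V) in pq.
have f0 : annihilator V != 0 by rewrite monic_neq0 // annihilator_monic.
have [g qg] : exists g, q = g \Po annihilator V.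
  apply: IHn => [|c Vc].
    rewrite ltnS in sp; apply: leq_trans sp.
    have [->|q0] := eqVneq q 0; first by rewrite size_poly0 ltnW.
    have : size (p - (p.[0])%:P) = size p.
      by rewrite -polyCN size_polyDl // (leq_ltn_trans (size_polyC_leq1 _)).
    rewrite pq size_Mmonic ?annihilator_monic // size_annihilator addnS /= =>
      <-.
    by rewrite -{1}[size q]addn0 ltn_add2l; case: (V) V0.
  apply: (mulIf f0); rewrite -pq -{1}(translate_annihilator aV Vc) -rmorphM /=.
  by rewrite -pq rmorphB /= ip // translateC.
exists (g * 'X + (p.[0])%:P).
by rewrite comp_polyD comp_polyM comp_polyX comp_polyC -qg -pq subrK.
Qed.

(** The difference f(X + z) - f(X) is invariant under [V] and its leading terms cancel, so it is a
    constant, namely its value f(z) at 0. Thus f is additive. *)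
Lemma annihilatorD z : additive_seq V ->
  translate z (annihilator V) = annihilator V + ((annihilator V).[z])%:P.
Proof.
move=> aV; set f := annihilator V.
have mf := annihilator_monic V; have sf := size_annihilator V.
have iD : invariant_poly (translate z f - f).
  move=> c Vc; rewrite rmorphB /= translateD [c + z]addrC -translateD.
  by rewrite (translate_annihilator aV Vc).
have V0 : 0 \in V by case: aV.
have := invariant_const aV iD; rewrite !hornerE translateE add0r.
have -> : f.[0] = 0 by apply/eqP; rewrite -/(root f 0) root_annihilator.
rewrite subr0 => /(_ _) e; rewrite addrC -e ?subrK //.
have st : size (translate z f) = size f by rewrite size_translate.
rewrite -ltnS -sf -/f [X in (_ < X)%N]polySpred ?monic_neq0 // ltnS.
apply/leq_sizeP => j; rewrite leq_eqVlt => /orP[/eqP <-|lj].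
  rewrite coefB -[in f`_ _](lead_coefE f) (monicP mf).
  rewrite -{1}st -lead_coefE /translate lead_coef_comp ?size_XaddC //.
  by rewrite (monicP mf) lead_coefXaddC expr1n mul1r subrr.
have sj : (size f <= j)%N by rewrite (leq_trans (leqSpred _)).
by rewrite coefB !nth_default ?subrr ?st.
Qed.

(** For additive [V] this is f divided by X: among the elements of [V] it is nonzero only at 0,
    which makes its translates weights for averaging over [V]. *)
Definition cofactor0 := \prod_(c <- nonzeros V) ('X - c%:P).

Lemma annihilator_cofactor0 : additive_seq V -> annihilator V = 'X * cofactor0.
Proof.
case=> uV V0 _; rewrite /annihilator (perm_big _ (perm_to_rem V0)) big_cons
  subr0.
by rewrite rem_filter.
Qed.

Lemma cofactor0_neq0 : cofactor0.[0] != 0.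
Proof.
rewrite -/(root _ _) root_prod_XsubC mem_filter eqxx //.
Qed.

(** The trace is invariant of degree less than the order of [V], hence constant, and at 0 only the
    term [c = 0] survives. *)
Lemma sum_translate_cofactor0 : additive_seq V ->
  \sum_(c <- V) translate c cofactor0 = (cofactor0.[0])%:P.
Proof.
move=> aV; have [uV V0 VD] := aV.
set T := \sum_(c <- V) _.
have T0 : T.[0] = cofactor0.[0].
  rewrite horner_sum (perm_big _ (perm_to_rem V0)) big_cons translateE addr0.
  rewrite big_seq big1 /= ?addr0 // => c; rewrite mem_rem_uniq // inE.
  case/andP=> c0 Vc.
  apply/eqP; rewrite translateE add0r -/(root _ _) root_prod_XsubC mem_filter.
  by rewrite c0.
rewrite -T0; apply: invariant_const => //.
  move=> c Vc; rewrite /T rmorph_sum /= -[RHS](perm_big _ (additive_seq_shift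
    aV Vc)).
  by rewrite big_map; apply: eq_bigr => d _; rewrite translateD addrC.
have s0 : size cofactor0 = size V.
  by have := size_annihilator V; rewrite annihilator_cofactor0 // mulrC
    size_mulX
     ?(monic_neq0 (monic_prod_XsubC _ _ _)) // => -[].
apply: leq_trans (size_sum _ _ _) _.
by apply/bigmax_leqP_seq => c _ _; rewrite size_translate s0.
Qed.

(* Averaging against [cofactor0 V], whose trace is a nonzero constant. *)
Lemma additive_cocycle_coboundary (g : K -> {poly K}) : additive_seq V ->
    (forall c d, c \in V -> d \in V -> g (c + d) = translate d (g c) + g d) ->
  exists q, forall c, c \in V -> translate c q = q - g c.
Proof.
move=> aV gD; set t := cofactor0.[0].
exists (t^-1 *: \sum_(c <- V) translate c cofactor0 * g c) => d Vd.
have t0 : t != 0 := cofactor0_neq0.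
apply: (scalerI t0); rewrite scalerBr /translate comp_polyZ !scalerA mulfV //.
rewrite !scale1r -/(translate d _) rmorph_sum /=.
have shift (F : K -> {poly K}) : \sum_(c <- V) F (c + d) = \sum_(c <- V) F c.
  by rewrite -[RHS](perm_big _ (additive_seq_shift aV Vd)) big_map.
have -> : t *: g d = \sum_(c <- V) translate (c + d) cofactor0 * g d.
  by rewrite -mulr_suml (shift (translate^~ cofactor0)) sum_translate_cofactor0
    // mul_polyC.
(* Once reindexed by c -> c + d, the sums agree term by term thanks to the cocycle relation. *)
rewrite -[X in _ = X - _](shift (fun c => translate c cofactor0 * g c)) -sumrB.
apply: eq_big_seq => c Vc.
by rewrite rmorphM /= translateD [d + c]addrC gD // mulrDr addrK.
Qed.
End Translations.

(** * Artin-Schreier operator and additive polynomials *)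

Section ArtinSchreier.
Variables (p : nat) (R : comNzRingType).
Hypothesis charR : p \in [pchar R].
Implicit Types a b : R.

Lemma exprp_sum (I : Type) (r : seq I) (P : pred I) (F : I -> R) :
  (\sum_(i <- r | P i) F i) ^+ p = \sum_(i <- r | P i) F i ^+ p.
Proof. exact: (rmorph_sum (pFrobenius_aut charR)). Qed.

Lemma exprpD a b : (a + b) ^+ p = a ^+ p + b ^+ p.
Proof. exact: (rmorphD (pFrobenius_aut charR)). Qed.

Lemma exprpN a : (- a) ^+ p = - a ^+ p.
Proof. exact: (rmorphN (pFrobenius_aut charR)). Qed.

Lemma exprpnD n a b : (a + b) ^+ (p ^ n) = a ^+ (p ^ n) + b ^+ (p ^ n).
Proof.
by elim: n => [|n IHn]; rewrite ?expr1 // expnSr !exprM IHn exprpD.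
Qed.

Lemma artin_schreierD a b :
  (a + b) ^+ p - (a + b) = (a ^+ p - a) + (b ^+ p - b).
Proof. by rewrite exprpD; ring. Qed.

Lemma artin_schreierN a : (- a) ^+ p - (- a) = - (a ^+ p - a).
Proof. by rewrite exprpN opprB opprK addrC. Qed.

Lemma artin_schreierB a b :
  (a - b) ^+ p - (a - b) = (a ^+ p - a) - (b ^+ p - b).
Proof. by rewrite artin_schreierD artin_schreierN. Qed.

End ArtinSchreier.

Section Poly.
Variables (p : nat) (K : fieldType).
Hypothesis charK : p \in [pchar K].
Implicit Types (q g : {poly K}) (c : K).

Let p_pr : prime p := pcharf_prime charK.
Let p_gt1 : (1 < p)%N := prime_gt1 p_pr.
Let p_gt0 : (0 < p)%N := prime_gt0 p_pr.

Lemma charKX : p \in [pchar {poly K}].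
Proof. by rewrite pchar_poly. Qed.

Lemma exprp_poly q : q ^+ p = map_poly (pFrobenius_aut charK) q \Po 'X^p.
Proof.
elim/poly_ind: q => [|q c IHq]; first by rewrite expr0n gtn_eqF // !rmorph0.
rewrite (exprpD charKX) exprMn IHq rmorphD rmorphM /= map_polyX map_polyC /=.
by rewrite comp_polyD comp_polyM comp_polyX comp_polyC -polyC_exp.
Qed.

Lemma coef_exprp q j : (q ^+ p)`_j = if (p %| j)%N then q`_(j %/ p) ^+ p else 0.
Proof. by rewrite exprp_poly coef_comp_poly_Xn // coef_map. Qed.

Lemma size_artin_schreier q : (1 < size q)%N ->
  (size (q ^+ p - q)).-1 = (p * (size q).-1)%N.
Proof.
move=> q1; have e := size_exp q p.
have lt : (size q < size (q ^+ p))%N.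
  have : ((size q).-1 < (size (q ^+ p)).-1)%N by rewrite e ltn_Pmulr //; lia.
  by lia.
by rewrite size_polyDl ?size_polyN // e mulnC.
Qed.

Hypothesis perfK : forall z : K, exists t, t ^+ p = z.

(** When deg g = p m, subtracting (t X^m)^p - t X^m, with t^p the leading coefficient, trades the
    leading term for one of degree m; induction on the size ends at a constant or at a degree prime
    to p. *)
Lemma artin_schreier_reduce g : exists q,
  let g' := g + (q ^+ p - q) in
  (size g' <= 1)%N || ~~ (p %| (size g').-1)%N.
Proof.
have [n] := ubnP (size g); elim: n g => // n IHn g; rewrite ltnS => sg.
have [g1|g1] := leqP (size g) 1.
  by exists 0; rewrite /= expr0n gtn_eqF // subrr addr0 g1.
have [/dvdnP[m gm]|npg] := boolP (p %| (size g).-1)%N; last first.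
  by exists 0; rewrite /= expr0n gtn_eqF // subrr addr0 npg orbT.
have [t tp] := perfK (lead_coef g).
pose q1 := - (t *: 'X^m); pose g1' := g + (q1 ^+ p - q1).
have [|q2 gq2] := IHn g1'.
  apply: leq_trans sg; rewrite -[X in (_ < X)%N](ltn_predK g1) ltnS.
  have m0 : (m < (size g).-1)%N by rewrite gm ltn_Pmulr // lt0n;
    apply: contra_eq_neq gm => ->; lia.
  apply/leq_sizeP => j; rewrite /g1' /q1 (exprpN charKX) exprZn -exprM tp -gm.
  rewrite opprK !coefD coefN !coefZ !coefXn leq_eqVlt => /orP[/eqP <-|lj].
    by rewrite eqxx mulr1 (gtn_eqF m0) mulr0 addr0 subrr.
  rewrite (gtn_eqF lj) (gtn_eqF (ltn_trans m0 lj)) !mulr0 nth_default ?oppr0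
    ?addr0 //.
  by rewrite -(ltn_predK g1).
by exists (q1 + q2); rewrite (artin_schreierD charKX) addrA.
Qed.

End Poly.

Section PolyR.
Variables (p h : nat) (K : fieldType) (a : 'I_h.+1 -> K).
Hypothesis charK : p \in [pchar K].
Let p_pr : prime p := pcharf_prime charK.
Let p_gt1 : (1 < p)%N := prime_gt1 p_pr.
Let p_gt0 : (0 < p)%N := prime_gt0 p_pr.
Let R := polyR p a.

Lemma coef_polyR j :
  R`_j = \sum_(i < h.+1 | (p ^ i)%N == j) a i.
Proof. by rewrite coef_sumMXn. Qed.

Lemma coef_polyR_exp (i : 'I_h.+1) : R`_(p ^ i) = a i.
Proof.
rewrite coef_polyR (big_pred1 i) // => j /=.
by rewrite eqn_exp2l // -val_eqE.
Qed.

Lemma coef_polyR0 j : (forall i : 'I_h.+1, (p ^ i)%N != j) -> R`_j = 0.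
Proof. by move=> ne; rewrite coef_polyR big_pred0 // => i; apply: negbTE. Qed.

Lemma size_polyR : (size R <= (p ^ h).+1)%N.
Proof.
apply/leq_sizeP => j lj; apply: coef_polyR0 => i.
by rewrite neq_ltn (leq_ltn_trans _ lj) // leq_exp2l // -ltnS.
Qed.

Lemma translate_polyR c : translate c R = R + (R.[c])%:P.
Proof.
rewrite /R /polyR rmorph_sum /= horner_sum rmorph_sum -big_split /=.
apply: eq_bigr => i _; rewrite /translate comp_polyZ comp_Xn_poly.
by rewrite (exprpnD (charKX charK)) scalerDr !hornerE polyCM polyC_exp
  mul_polyC.
Qed.

Lemma deriv_polyR : R^`() = (a ord0)%:P.
Proof.
rewrite /R /polyR raddf_sum /= big_ord_recl big1 ?addr0 => [|i _].
  by rewrite derivZ derivXn expn0 expr0 alg_polyC.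
by rewrite derivZ derivXn lift0 expnS mulrnA (mulrn_pchar (charKX charK))
  mul0rn scaler0.
Qed.

Lemma polyR_opp : odd p -> R \Po (- 'X) = - R.
Proof.
move=> odd_p; rewrite /R /polyR rmorph_sum -sumrN /=; apply: eq_bigr => i _.
rewrite comp_polyZ comp_Xn_poly.
by rewrite exprNn -signr_odd oddX odd_p orbT mulN1r scalerN.
Qed.
End PolyR.

(** * The equation of the quotient *)

Section Cofactor.
Variables (K : fieldType) (V : seq K).
Hypothesis aV : additive_seq V.

(** Differentiation preserves invariance, and the degree drops below the order of [V], so the
    derivative is constant; its value at 0 is read from f = X * [cofactor0 V]. *)
Lemma deriv_annihilator : (annihilator V)^`() = ((cofactor0 V).[0])%:P.
Proof.
have [_ V0 _] := aV; set f := annihilator V.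
have if' : invariant_poly V f^`().
  move=> c Vc; rewrite -{2}[f](translate_annihilator aV Vc) /translate.
  by rewrite deriv_comp derivD derivX derivC addr0 mulr1.
rewrite (invariant_const aV if') //.
  rewrite /f annihilator_cofactor0 // derivM derivX !hornerE //.
have := lt_size_deriv (monic_neq0 (annihilator_monic V)).
by rewrite size_annihilator.
Qed.

Lemma size_nonzeros : size V = (size (nonzeros V)).+1.
Proof.
have [uV V0 _] := aV.
by rewrite (perm_size (perm_to_rem V0)) /= rem_filter.
Qed.

(** The number of nonzero elements is even, so the signs of the factors - c cancel. *)
Lemma cofactor0_prod : odd (size V) ->
  (cofactor0 V).[0] = \prod_(c <- nonzeros V) c.
Proof.
rewrite size_nonzeros /= => /negbTE ev.
rewrite /cofactor0 horner_prod.
under eq_bigr => c _ do rewrite hornerXsubC sub0r -mulN1r -[-1 in X in X *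
  _]expr1.
by rewrite big_split /= prodrXr sum1_size -signr_odd ev mul1r.
Qed.

(** [V] is stable under opposites and has an odd number of elements. *)
Lemma annihilator_opp : odd (size V) ->
  annihilator V \Po (- 'X) = - annihilator V.
Proof.
move=> oV; have [uV _ _] := aV.
have pN : perm_eq [seq - c | c <- V] V.
  have uN : uniq [seq - c | c <- V] by rewrite map_inj_uniq //; apply: oppr_inj.
  have sub : {subset [seq - c | c <- V] <= V}.
    by move=> _ /mapP[c Vc ->]; apply: additive_seqN.
  have [|_ eqV] := uniq_min_size uN sub; first by rewrite size_map.
  exact: uniq_perm.
rewrite /annihilator rmorph_prod -[in RHS](perm_big _ pN) big_map /=.
have -> : \prod_(c <- V) (('X - c%:P) \Po - 'X) =
          \prod_(c <- V) ((-1) ^+ 1 * ('X - (- c)%:P)).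
  apply: eq_bigr => c _.
  by rewrite rmorphB /= comp_polyX comp_polyC expr1 polyCN; ring.
by rewrite big_split /= prodrXr sum1_size -signr_odd oV mulN1r.
Qed.

End Cofactor.

Section QuotientEquation.
Variables (p h : nat) (K : fieldType) (a : 'I_h.+1 -> K) (V : seq K).
Hypothesis charK : p \in [pchar K].
Hypothesis odd_p : odd p.
Hypothesis aV : additive_seq V.
Hypothesis sV : size V = (p ^ h)%N.

Let p_pr : prime p := pcharf_prime charK.
Let p_gt1 : (1 < p)%N := prime_gt1 p_pr.
Let p_gt2 : (2 < p)%N.
Proof. by rewrite odd_prime_gt2. Qed.

Let R := polyR p a.
Let f := annihilator V.
Let t := \prod_(c <- nonzeros V) c.

Let odd_sV : odd (size V).
Proof. by rewrite sV oddX odd_p orbT. Qed.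

Let two_neq0 : 2 != 0 :> K.
Proof. by rewrite -(dvdn_pcharf charK) gtnNdvd. Qed.

Lemma prod_nonzeros_neq0 : t != 0.
Proof. by rewrite /t -cofactor0_prod // cofactor0_neq0. Qed.

Lemma annihilator0 : f.[0] = 0.
Proof. by apply/eqP; rewrite -/(root f 0) root_annihilator; case: aV. Qed.

(* The leading terms of [g \Po f] are compared after differentiation, which
   kills [q ^+ p] and makes the derivative of [f] constant. *)
Lemma quotient_degree (q g : {poly K}) : (0 < h)%N ->
    'X * R + (q ^+ p - q) = g \Po f -> g.[0] = 0 ->
    (size g <= 1)%N || ~~ (p %| (size g).-1)%N ->
  exists al be, g = al *: 'X^2 + be *: 'X /\ 2 * al * t = a ord_max.
Proof.
move=> h0 qg g0 pg.
have df : f^`() = t%:P by rewrite deriv_annihilator // cofactor0_prod.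
have deq : (g^`() \Po f) * t%:P = R + (a ord0)%:P * 'X - q^`().
  rewrite -df -deriv_comp -qg derivD derivM derivX mul1r deriv_polyR //.
  rewrite derivB deriv_exp (mulrn_pchar (charKX charK)) sub0r.
  by rewrite [_ * 'X]mulrC.
pose n := (p ^ h)%N; have sVn : size V = n := sV.
have [m nm m0] : exists2 m, n = (p * m)%N & (0 < m)%N.
  by exists (p ^ h.-1)%N; rewrite ?expn_gt0 ?prime_gt0 // -expnS prednK.
have n0 : (0 < n)%N by rewrite nm muln_gt0 m0 prime_gt0.
have sR : (size ('X * R)%R <= n.+2)%N.
  apply: leq_trans (size_polyMleq _ _) _; rewrite size_polyX /=.
  by have := size_polyR a charK.
have sf : size f = n.+1 by rewrite size_annihilator sVn.
have sgf : (size (g \Po f)).-1 = ((size g).-1 * n)%N by rewrite size_comp_poly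
  sf.
have sq : (p * (size q).-1 <= maxn ((size g).-1 * n) n.+1)%N.
  have [q1|q1] := leqP (size q) 1; first by move/eqP: q1; rewrite subn1 => ->;
    rewrite muln0.
  rewrite -(size_artin_schreier charK q1).
  have -> : q ^+ p - q = (g \Po f) - 'X * R by rewrite -qg [RHS]addrC addKr.
  have := size_polyD (g \Po f) (- ('X * R)); rewrite size_polyN -sgf.
  move: (size _) (size _) (size _) sR => s1 s2 s3; lia.
have sq' : (size q^`() <= (size q).-1)%N.
  have [->|q0] := eqVneq q 0; first by rewrite deriv0 size_poly0.
  by have := lt_size_deriv q0; lia.
(* Since p deg q is at most max(n deg g, n + 1), hence at most n d = p m d, the derivative of q has
   degree below d m. *)
have coefq' d j : ((size g).-1 <= d)%N -> (1 < d)%N -> (d * m <= j)%N ->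
  q^`()`_j = 0.
  move=> dg d1 dj; apply: nth_default; apply: leq_trans sq' _;
    apply: leq_trans dj.
  have pos := prime_gt0 p_pr.
  rewrite -(leq_pmul2l pos); apply: leq_trans sq _.
  rewrite geq_max mulnCA -nm leq_mul2r dg orbT /=.
  by apply: (@leq_trans (2 * n)); [lia | rewrite leq_mul2r d1 orbT].
(* If d = deg g were at least 3, the nonzero coefficient of degree (d - 1) n on the left would have
   no counterpart: R and X stop at degree n, and (d - 1) n is at least d m, beyond the derivative of
   q. *)
have g3 : (size g <= 3)%N.
  rewrite leqNgt; apply/negP => g4; set d := (size g).-1 in coefq' sgf sq.
  have d3 : (2 < d)%N by rewrite /d; lia.
  have pd : ~~ (p %| d)%N by move: pg; rewrite leqNgt (ltn_trans _ g4).
  have sg' : size g^`() = d.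
    apply/eqP; rewrite eqn_leq; apply/andP; split.
      have := lt_size_deriv (_ : g != 0); rewrite -size_poly_gt0 (ltn_trans _
        g4) //.
      by rewrite /d => /(_ isT); lia.
    rewrite -[X in (X <= _)%N](ltn_predK d3).
    have : g^`()`_d.-1 != 0.
      rewrite coef_deriv (ltn_predK d3) -mulr_natr mulf_neq0 //.
        by rewrite -lead_coefE lead_coef_eq0 -size_poly_gt0 (ltn_trans _ g4).
      by rewrite -(dvdn_pcharf charK).
    by apply: contraNT; rewrite -leqNgt => ?; rewrite nth_default.
  have j1 : (n < d.-1 * n)%N by rewrite ltn_Pmull //; lia.
  have : ((g^`() \Po f) * t%:P)`_(d.-1 * n) != 0.
    rewrite coefMC mulf_neq0 ?prod_nonzeros_neq0 //.
    have -> : (d.-1 * n)%N = (size (g^`() \Po f)).-1.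
      by rewrite size_comp_poly sf sg'.
    rewrite -lead_coefE lead_coef_eq0 comp_poly_eq0 ?sf ?ltnS //.
    by rewrite -size_poly_gt0 sg'; lia.
  rewrite deq coefB coefD coefCM coefX (coefq' d) ?(ltnW d3) //.
    rewrite subr0 nth_default; last exact: leq_trans (size_polyR a charK) _.
    by rewrite add0r gtn_eqF ?mulr0 ?eqxx // (leq_ltn_trans n0 j1).
  rewrite nm mulnA leq_mul2r; apply/orP; right.
  by apply: (@leq_trans (d.-1 * 2)); [lia | rewrite leq_mul2l p_gt1 orbT].
have gE : g = g`_2 *: 'X^2 + g`_1 *: 'X.
  apply/polyP => -[|[|[|j]]]; rewrite !(coefD, coefZ, coefXn, coefX) /=.
  - by rewrite !mulr0 addr0 -horner_coef0.
  - by rewrite mulr0 mulr1 add0r.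
  - by rewrite mulr0 mulr1 addr0.
  - by rewrite nth_default ?(leq_trans g3) // !mulr0 addr0.
exists g`_2, g`_1; split=> //.
(* In degree n only the quadratic term of g contributes on the left, f being monic, and only a_h on
   the right, since n > 1. *)
have : ((g^`() \Po f) * t%:P)`_n = 2 * g`_2 * t.
  rewrite [in g^`()]gE derivD !derivZ derivXn derivX /= -scaler_nat.
  rewrite comp_polyD !comp_polyZ comp_polyX.
  rewrite rmorph1 coefMC !coefD !coefZ coef1 (gtn_eqF n0) mulr0 addr0.
  have -> : f`_n = 1.
    by rewrite -[n]/(n.+1.-1) -sf -lead_coefE (monicP (annihilator_monic V)).
  by rewrite mulr1 [g`_2 * 2]mulrC.
rewrite deq coefB coefD coefCM coefX (coefq' 2) //.
- move=> <-; rewrite /n (coef_polyR_exp a charK ord_max) gtn_eqF ?mulr0 ?addr0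
  ?subr0 //.
  by rewrite -[X in (X < _)%N](expn0 p) ltn_exp2l.
- by rewrite -subn1 leq_subLR.
- by rewrite nm leq_mul2r p_gt1 orbT.
Qed.

Hypothesis perfK : forall z : K, exists z', z' ^+ p = z.

(** The analogue of [coefA] for the list [V], available before [V] is identified with the image of
    the maximal abelian group. *)
Definition quotient_coef := if h == 0 then a ord0 else a ord_max / 2 * t.

Lemma quotient_equation (g : K -> {poly K}) :
    (forall c d, c \in V -> d \in V -> g (c + d) = translate d (g c) + g d) ->
    (forall c, c \in V -> g c ^+ p - g c = translate c ('X * R) - 'X * R) ->
  exists q al be, [/\ forall c, c \in V -> translate c q = q - g c,
    'X * R + (q ^+ p - q) = al *: f ^+ 2 + be *: f &
    al * t ^+ 2 = quotient_coef].
Proof.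
move=> gD gE; have charX := charKX charK.
(* For h = 0 the group is trivial, f = X and X R = a_0 X^2, so q = 0 works. *)
have [h0|h0] := posnP h.
  have V1 : V = [:: 0].
    move: sV; rewrite h0; have [_ V0 _] := aV.
    by case: (V) V0 => [|c [|]] //; rewrite inE => /eqP <-.
  have fX : f = 'X by rewrite /f V1 /annihilator big_seq1 subr0.
  exists 0, (a ord0), 0; split.
  - have := gD 0 0; rewrite V1 inE eqxx addr0 translate0 => /(_ isT isT).
    move/eqP; rewrite eq_sym -subr_eq0 addrK => /eqP g0 c;
      rewrite inE => /eqP ->.
    by rewrite g0 subr0 translate0.
  - rewrite expr0n gtn_eqF ?prime_gt0 // subrr scale0r !addr0 fX expr2.
    rewrite /R /polyR big_ord_recl big1 ?addr0 /= => [|[i lt_ih]].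
      by rewrite expn0 expr1 -scalerAr.
    by have := lt_ih; rewrite {1}h0.
  - rewrite /quotient_coef ifT; last by rewrite h0.
    by rewrite /t V1 /nonzeros /= eqxx big_nil expr1n mulr1.
have [q0 q0E] := additive_cocycle_coboundary aV gD.
have inv0 : invariant_poly V ('X * R + (q0 ^+ p - q0)).
  move=> c Vc; rewrite rmorphD rmorphB rmorphXn /= q0E //.
  rewrite (artin_schreierB charX) gE //; ring.
have [g0 g0E] := invariant_polyE aV inv0.
have [q1 q1P] := artin_schreier_reduce charK perfK g0.
(* The constant e normalizes q(0) to 0, which forces g'(0) = 0 as [quotient_degree] requires;
   composing [q1] with f keeps the equation a polynomial in f. *)
pose e := q0.[0] + q1.[0]; pose q := q0 + (q1 \Po f) - e%:P.
pose g' := g0 + (q1 ^+ p - q1) - (e ^+ p - e)%:P.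
have qg : 'X * R + (q ^+ p - q) = g' \Po f.
  have -> : g' \Po f = (g0 \Po f) + ((q1 \Po f) ^+ p - (q1 \Po f))
                      - (e%:P ^+ p - e%:P).
    rewrite /g' -polyCN !(comp_polyB, comp_polyD) comp_polyC rmorphXn /=.
    by rewrite polyCN polyCB polyC_exp.
  by rewrite /q (artin_schreierB charX) (artin_schreierD charX) !addrA -g0E
    !addrA.
have q00 : q.[0] = 0.
  rewrite /q !hornerE horner_comp annihilator0 /e; ring.
have g'0 : g'.[0] = 0.
  move/(congr1 (horner^~ 0)): qg.
  rewrite horner_comp annihilator0 => <-.
  rewrite hornerD hornerM hornerX mul0r add0r hornerD hornerN horner_exp q00.
  by rewrite expr0n gtn_eqF ?prime_gt0 // subrr.
have [|al [be [g'E alE]]] := quotient_degree h0 qg g'0.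
  have size_const c : (size (- c%:P : {poly K}) <= 1)%N.
    by rewrite size_polyN size_polyC_leq1.
  have [G1|G1] := leqP (size (g0 + (q1 ^+ p - q1))) 1.
    by rewrite (leq_trans (size_polyD _ _)) // geq_max G1 size_const.
  move: q1P; rewrite /= leqNgt G1 /= => q1P.
  by rewrite /g' size_polyDl ?q1P ?orbT // (leq_ltn_trans (size_const _)).
exists q, al, be; split.
- move=> c Vc; rewrite /q rmorphB rmorphD /= q0E // translateC.
  rewrite [translate c (q1 \Po f)]/translate -comp_polyA -/(translate c f).
  by rewrite translate_annihilator //; ring.
- by rewrite qg g'E comp_polyD !comp_polyZ comp_polyX comp_Xn_poly.
- rewrite /quotient_coef gtn_eqF // -alE; field; exact: two_neq0.
Qed.

(** X R is even and f is odd, so m = (q - q(-X)) / 2 isolates the linear term; 1/2 lies in the prime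
    field, so halving commutes with the Artin-Schreier operator. *)
Lemma parity_split (q : {poly K}) al be :
    'X * R + (q ^+ p - q) = al *: f ^+ 2 + be *: f ->
  exists m, m ^+ p - m = be *: f /\
    'X * R + ((q - m) ^+ p - (q - m)) = al *: f ^+ 2.
Proof.
move=> qE; have charX := charKX charK.
have qN : 'X * R + ((q \Po - 'X) ^+ p - (q \Po - 'X)) = al *: f ^+ 2 - be *: f.
  move/(congr1 (comp_poly (- 'X))): qE.
  rewrite !(rmorphD, rmorphB, rmorphM) /= rmorphXn comp_polyX polyR_opp //.
  rewrite !comp_polyZ rmorphXn /= annihilator_opp // sqrrN scalerN => <-.
  by rewrite raddfN mulrNN.
have half : (2^-1 : K) ^+ p = 2^-1.
  by rewrite exprVn -[2 ^+ p]/(pFrobenius_aut charK 2) pFrobenius_aut_nat.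
exists (2^-1 *: (q - (q \Po - 'X))).
have mE : (2^-1 *: (q - (q \Po - 'X))) ^+ p - (2^-1 *: (q - (q \Po - 'X))) = be
  *: f.
  rewrite exprZn half -scalerBr (artin_schreierB charX).
  apply: (scalerI two_neq0); rewrite scalerA mulfV // scale1r.
  have -> : q ^+ p - q = al *: f ^+ 2 + be *: f - 'X * R by rewrite -qE; ring.
  have -> : (q \Po - 'X) ^+ p - (q \Po - 'X) = al *: f ^+ 2 - be *: f - 'X * R.
    by rewrite -qN; ring.
  by rewrite scaler_nat; ring.
split=> //.
rewrite (artin_schreierB charX) mE addrA qE; ring.
Qed.

End QuotientEquation.

(** * Removing the linear term; shifts commuting with the group *)

Section RootE.
Variables (p h : nat) (K : fieldType) (a : 'I_h.+1 -> K).
Hypothesis charK : p \in [pchar K].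
Let p_pr : prime p := pcharf_prime charK.
Let p_gt1 : (1 < p)%N := prime_gt1 p_pr.
Let p_gt0 : (0 < p)%N := prime_gt0 p_pr.
Let R := polyR p a.

(* With [d_j] and [r_j] the coefficients of ['X^(p ^ j)], the hypothesis reads
   [d_0 = - r_0] and [d_(j+1) = d_j ^+ p - r_(j+1)]. As [r_j = 0] for [j > h]
   and [d] has finite support, [d_h = 0], which is [E(w) = 0]. *)
Lemma root_polyE (w e : K) (d : {poly K}) :
  d ^+ p - d = w *: R + R.[w] *: 'X + e%:P -> root (polyE p a) w.
Proof.
move=> dE; pose r j := (w *: R + R.[w] *: 'X + e%:P)`_(p ^ j).
have pn0 j : (p ^ j != 0)%N by rewrite -lt0n expn_gt0 p_gt0.
have rE j : r j = w * R`_(p ^ j) + R.[w] * (j == 0%N)%:R.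
  rewrite /r !coefD !coefZ coefX coefC (negPf (pn0 j)) addr0.
  by rewrite -[X in _ == X](expn0 p) eqn_exp2l.
have d0 : d`_(p ^ 0) = - r 0%N.
  rewrite /r -dE coefB (coef_exprp charK) expn0 dvdn1 (gtn_eqF p_gt1).
  by rewrite sub0r opprK.
have dS j : d`_(p ^ j.+1) = d`_(p ^ j) ^+ p - r j.+1.
  rewrite /r -dE coefB (coef_exprp charK) expnS dvdn_mulr // mulKn //.
  by ring.
have dsum j : d`_(p ^ j) = - \sum_(i < j.+1) r i ^+ (p ^ (j - i)).
  elim: j => [|j IHj]; first by rewrite big_ord1 d0 expr1.
  rewrite dS IHj [in RHS]big_ord_recr /= subnn expr1 opprD (exprpN charK).
  congr (- _ - _); rewrite (exprp_sum charK); apply: eq_bigr => i _.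
  by rewrite -exprM -expnSr subSn // -ltnS.
have dh m : d`_(p ^ (h + m)) = d`_(p ^ h) ^+ (p ^ m).
  elim: m => [|m IHm]; first by rewrite addn0 expr1.
  rewrite addnS dS IHm -exprM -expnSr rE mulr0 addr0 coef_polyR0 ?mulr0 ?subr0
    //.
  move=> i; rewrite eqn_exp2l //; have := ltn_ord i; lia.
have : d`_(p ^ h) = 0.
  (* With m = [size d], the index p^(h + m) lies beyond the support of d. *)
  apply/eqP; have := dh (size d); rewrite nth_default.
    by move/esym/eqP; rewrite expf_eq0 => /andP[].
  apply: leq_trans (leq_pexp2l p_gt0 (leq_addl h _)).
  by apply: ltnW; apply: ltn_expl.
rewrite dsum => /eqP; rewrite oppr_eq0 /root.
suff -> : (polyE p a).[w] = \sum_(i < h.+1) r i ^+ (p ^ (h - i)) by [].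
rewrite /polyE hornerD horner_exp -/R; move: R.[w] rE => Rw rE.
(* The first two summands, R(w)^(p^h) and (a_0 w)^(p^h), together make up the Frobenius power of
   [r 0]. *)
rewrite horner_sum big_ord_recl [in RHS]big_ord_recl addrA; congr (_ + _).
  rewrite rE expn0 mulr1 subn0 (coef_polyR_exp a charK ord0).
  by rewrite (exprpnD charK) addrC horner_exp hornerZ hornerX mulrC.
apply: eq_bigr => i _.
rewrite rE lift0 mulr0 addr0 horner_exp hornerZ hornerX mulrC.
by rewrite -(coef_polyR_exp a charK (lift ord0 i)) lift0.
Qed.

End RootE.

Section Maps.
Variables (K k : fieldType) (iota : {rmorphism K -> k}).

Lemma map_polyR p h (a : 'I_h.+1 -> K) :
  map_poly iota (polyR p a) = polyR p (iota \o a).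
Proof.
rewrite /polyR rmorph_sum; apply: eq_bigr => i _ /=.
by rewrite map_polyZ map_polyXn.
Qed.

Lemma map_poly_polyE p h (a : 'I_h.+1 -> K) :
  map_poly iota (polyE p a) = polyE p (iota \o a).
Proof.
rewrite /polyE rmorphD rmorphXn /= map_polyR rmorph_sum; congr (_ + _).
by apply: eq_bigr => i _ /=; rewrite rmorphXn /= map_polyZ map_polyX.
Qed.

Lemma map_annihilator (V : seq K) :
  map_poly iota (annihilator V) = annihilator (map iota V).
Proof.
rewrite /annihilator rmorph_prod big_map; apply: eq_bigr => c _ /=.
by rewrite rmorphB /= map_polyX map_polyC.
Qed.

Lemma map_additive_seq (V : seq K) : additive_seq V -> additive_seq (map iota
  V).
Proof.
case=> uV V0 VD; split.
- by rewrite map_inj_uniq //; apply: fmorph_inj.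
- by apply/mapP; exists 0; rewrite ?rmorph0.
- move=> _ _ /mapP[c Vc ->] /mapP[d Vd ->]; rewrite -rmorphD.
  by apply: map_f; apply: VD.
Qed.

Lemma map_translate (c : K) (q : {poly K}) :
  map_poly iota (translate c q) = translate (iota c) (map_poly iota q).
Proof. by rewrite /translate map_comp_poly rmorphD /= map_polyX map_polyC. Qed.

End Maps.

Section Consequences.
Variables (p h : nat) (K : fieldType) (a : 'I_h.+1 -> K) (V : seq K).
Hypothesis charK : p \in [pchar K].
Hypothesis odd_p : odd p.
Hypothesis aV : additive_seq V.
Hypothesis sV : size V = (p ^ h)%N.

Let p_pr : prime p := pcharf_prime charK.
Let p_gt1 : (1 < p)%N := prime_gt1 p_pr.
Let two_neq0 : 2 != 0 :> K.
Proof. by rewrite -(dvdn_pcharf charK) gtnNdvd // odd_prime_gt2. Qed.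

Let R := polyR p a.
Let f := annihilator V.

Variables (q : {poly K}) (al be : K).
Hypothesis qE : 'X * R + (q ^+ p - q) = al *: f ^+ 2 + be *: f.
Hypothesis al_neq0 : al != 0.

(* [w] with [f(w) = e] is a root of [E], hence lies in [K]; then, with [m] the
   odd part of [q], one can take [z = m(w) / 2]. *)
Lemma linear_term_removal (k : closedFieldType) (iota : {rmorphism K -> k}) :
    (forall w, root (polyE p (iota \o a)) w -> exists w', w = iota w') ->
  exists e z : K, be = 2 * al * e /\ z ^+ p - z = al * e ^+ 2.
Proof.
move=> rootsE; have [m [mE qmE]] := parity_split charK odd_p aV sV qE.
pose e := be / (2 * al); have beE : be = 2 * al * e.
  by rewrite /e mulrC divfK // mulf_neq0.
have chark : p \in [pchar k] by rewrite (fmorph_pchar iota).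
have charX := charKX chark.
have [w] : exists w, root (map_poly iota (f - e%:P)) w.
  apply/closed_rootP; rewrite size_map_poly size_polyDl size_annihilator sV.
    by rewrite eqSS -lt0n expn_gt0 prime_gt0.
  rewrite size_polyN (leq_ltn_trans (size_polyC_leq1 _)) //.
  by rewrite ltnS expn_gt0 prime_gt0.
rewrite /root rmorphB /= map_polyC hornerD hornerN hornerC subr_eq0 => /eqP fw.
set fk := map_poly iota f in fw; set Q := map_poly iota (q - m).
set M := map_poly iota m; set Rk := map_poly iota R.
have fkE : fk = annihilator (map iota V) by rewrite /fk map_annihilator.
have fkD : translate w fk = fk + (iota e)%:P.
  by rewrite -fw fkE annihilatorD //; apply: map_additive_seq.
have RkD : translate w Rk = Rk + (Rk.[w])%:P.
  by rewrite /Rk map_polyR translate_polyR.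
have ME : M ^+ p - M = iota be *: fk.
  by rewrite /M -rmorphXn -rmorphB mE /= map_polyZ.
have QE : 'X * Rk + (Q ^+ p - Q) = iota al *: fk ^+ 2.
  rewrite /Q -rmorphXn -rmorphB -[fk ^+ 2]rmorphXn -map_polyZ -qmE.
  by rewrite [RHS]rmorphD /= [map_poly _ (_ * _)]rmorphM /= map_polyX.
have [w' ww'] : exists w', w = iota w'.
  apply: rootsE.
  (* The Artin-Schreier image of M cancels the linear term 2 al e f of al (f + e)^2 - al f^2, where
     f(X + w) = f + e; what remains is w R + R(w) X plus a constant. *)
  apply: (@root_polyE _ _ _ _ chark w (w * Rk.[w] - iota (al * e ^+ 2))
            (M - translate w Q + Q)).
  rewrite -map_polyR -/R -/Rk (artin_schreierD charX) (artin_schreierB charX)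
    ME.
  have QwE : ('X + w%:P) * (Rk + (Rk.[w])%:P) + (translate w Q ^+ p - translate
    w Q)
      = iota al *: (fk + (iota e)%:P) ^+ 2.
    rewrite -RkD -translateX -fkD -[translate w Q ^+ p]rmorphXn -rmorphM
      -rmorphB.
    by rewrite -rmorphD QE /= /translate comp_polyZ rmorphXn.
  have -> : translate w Q ^+ p - translate w Q =
     iota al *: (fk + (iota e)%:P) ^+ 2 - ('X + w%:P) * (Rk + (Rk.[w])%:P).
    by rewrite -QwE; ring.
  have -> : Q ^+ p - Q = iota al *: fk ^+ 2 - 'X * Rk by rewrite -QE; ring.
  have -> : iota be = 2 * iota al * iota e by rewrite beE !rmorphM rmorph_nat.
  have -> : iota (al * e ^+ 2) = iota al * iota e ^+ 2 by rewrite rmorphM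
    rmorphXn.
  rewrite -!mul_polyC polyCB [(_ * _ ^+ 2)%:P]polyCM polyC_exp !polyCM.
  rewrite polyC_natr; ring.
exists e, (m.[w'] / 2); split=> //.
have half : (2^-1 : K) ^+ p = 2^-1.
  by rewrite exprVn -[2 ^+ p]/(pFrobenius_aut charK 2) pFrobenius_aut_nat.
have fw' : f.[w'] = e.
  by apply: (fmorph_inj iota); rewrite -horner_map -ww' -fw.
(* At w' the relation for m reads m(w')^p - m(w') = be e = 2 al e^2, and halving it gives the
   equation for z. *)
have := congr1 (horner^~ w') mE.
rewrite hornerZ hornerD hornerN horner_exp fw' exprMn half -mulrBl => ->.
by rewrite beE; field.
Qed.

(* Otherwise [d := g0 + translate c0 q - q] would be invariant under [V], with
   [d ^+ p - d] of degree exactly [size V]. *)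
Lemma commuting_shift (g : K -> {poly K}) (c0 : K) (g0 : {poly K}) :
    (forall c, c \in V -> translate c q = q - g c) ->
    g0 ^+ p - g0 = translate c0 ('X * R) - 'X * R ->
    (forall c, c \in V -> translate c g0 + g c = translate c0 (g c) + g0) ->
  c0 \in V.
Proof.
move=> qV g0E g0V; have charX := charKX charK.
rewrite -root_annihilator -/f; apply: contraT => fc0.
pose d := g0 + translate c0 q - q.
have id : invariant_poly V d.
  move=> c Vc; rewrite /d rmorphB rmorphD /= (qV c) // translateD.
  rewrite [c + c0]addrC -translateD (qV c) // rmorphB /=.
  have -> : translate c g0 = translate c0 (g c) + g0 - g c by rewrite -g0V //;
    ring.
  by ring.
have dE : d ^+ p - d = (2 * al * f.[c0]) *: f + (al * f.[c0] ^+ 2 + be *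
  f.[c0])%:P.
  rewrite /d (artin_schreierB charX) (artin_schreierD charX) g0E.
  have := congr1 (translate c0) qE.
  rewrite [in LHS]rmorphD rmorphB rmorphXn rmorphD /=.
  rewrite ![translate c0 (_ *: _)]/translate !comp_polyZ -!/(translate c0 _).
  rewrite rmorphXn /= annihilatorD // -/f => qE'.
  have -> : translate c0 q ^+ p - translate c0 q = al *: (f + (f.[c0])%:P) ^+ 2
      + be *: (f + (f.[c0])%:P) - translate c0 ('X * R) by rewrite -qE'; ring.
  have -> : q ^+ p - q = al *: f ^+ 2 + be *: f - 'X * R by rewrite -qE; ring.
  rewrite -!mul_polyC !polyCD [(_ * _ ^+ 2)%:P]polyCM polyC_exp !polyCM
    polyC_natr; ring.
have sd : (size (d ^+ p - d)).-1 = (p ^ h)%N.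
  have nz : 2 * al * f.[c0] != 0 by rewrite !mulf_neq0.
  rewrite dE size_polyDl size_scale // size_annihilator sV //.
  by rewrite (leq_ltn_trans (size_polyC_leq1 _)) // ltnS expn_gt0 prime_gt0.
have p0 : (0 < p ^ h)%N by rewrite expn_gt0 prime_gt0.
(* A constant d is excluded by the degree; otherwise p deg d = p^h puts deg d below the order of
   [V], and invariance makes d constant after all. *)
have [d1|d1] := leqP (size d) 1.
  move: sd; rewrite (size1_polyC d1) -polyC_exp -polyCB => sd.
  by have := size_polyC_leq1 (d`_0 ^+ p - d`_0);
    rewrite -subn_eq0 subn1 sd -leqn0 leqNgt p0.
move: sd; rewrite size_artin_schreier // => sd.
have : (size d <= size V)%N.
  rewrite sV -sd -[X in (X <= _)%N](ltn_predK d1).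
  by rewrite ltn_Pmull //; lia.
move/(invariant_const aV id) => dc.
by move: d1; rewrite dc ltnNge size_polyC_leq1.
Qed.

End Consequences.

(** * Function fields of Artin-Schreier curves *)

Section Adjoin2.
Variables (F L : fieldType) (i : {rmorphism F -> L}) (x y : L).

(** [adjoin2] quantifies over boolean predicates, so the set [P] is made boolean classically; it
    contains 1 as the image of 1 under [i]. *)
Lemma adjoin2_ind (P : set L) :
    (forall t, P (i t)) -> P x -> P y ->
    (forall z w, P z -> P w -> P (z - w)) ->
    (forall z w, P z -> P w -> P (z / w)) ->
  adjoin2 i x y `<=` P.
Proof.
move=> Pi Px Py PB Pd z /(_ [pred w | `[< P w >]]) Mz.
apply/asboolP; apply: Mz => [|t||]; last 3 first; try by apply/asboolP.
split=> [|w w' /asboolP Pw /asboolP Pw'|w w' /asboolP Pw /asboolP Pw'].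
- by apply/asboolP; rewrite -(rmorph1 i); apply: Pi.
- by apply/asboolP/PB.
- by apply/asboolP/Pd.
Qed.

Lemma adjoin2_base t : adjoin2 i x y (i t).
Proof. by move=> S _ SF _ _; apply: SF. Qed.

Lemma adjoin2_x : adjoin2 i x y x.
Proof. by []. Qed.

Lemma adjoin2_y : adjoin2 i x y y.
Proof. by []. Qed.

Lemma adjoin2B z w : adjoin2 i x y z -> adjoin2 i x y w -> adjoin2 i x y (z -
  w).
Proof. by move=> Mz Mw S SS SF Sx Sy; have [_ SB _] := SS; apply: SB; auto. Qed.

Lemma adjoin2_div z w : adjoin2 i x y z -> adjoin2 i x y w -> adjoin2 i x y (z
  / w).
Proof. by move=> Mz Mw S SS SF Sx Sy; have [_ _ Sd] := SS; apply: Sd; auto. Qed.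

Lemma adjoin2D z w : adjoin2 i x y z -> adjoin2 i x y w -> adjoin2 i x y (z +
  w).
Proof.
move=> Mz Mw; rewrite -[w]opprK; apply: adjoin2B => //.
by rewrite -sub0r -(rmorph0 i); apply: adjoin2B => //; apply: adjoin2_base.
Qed.

Lemma adjoin2M z w : adjoin2 i x y z -> adjoin2 i x y w -> adjoin2 i x y (z *
  w).
Proof.
move=> Mz Mw; rewrite -[w]invrK; apply: adjoin2_div => //.
by rewrite -div1r -(rmorph1 i); apply: adjoin2_div => //; apply: adjoin2_base.
Qed.

Lemma adjoin2_horner (q : {poly F}) z :
  adjoin2 i x y z -> adjoin2 i x y (map_poly i q).[z].
Proof.
move=> Mz; elim/poly_ind: q => [|q c Mq].
  by rewrite rmorph0 horner0 -(rmorph0 i); apply: adjoin2_base.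
rewrite rmorphD rmorphM /= map_polyX map_polyC hornerMXaddC.
by apply: adjoin2D; [apply: adjoin2M | apply: adjoin2_base].
Qed.

End Adjoin2.

(** The lift sends b/d to e(b)/e(d) for a chosen representation; [e'E] shows that any other gives
    the same value, from which the ring laws follow. *)
Lemma fraction_lift (R : idomainType) (L : fieldType) (e : {rmorphism R -> L}) :
    (forall r, e r = 0 -> r = 0) ->
  exists e' : {rmorphism {fraction R} -> L}, forall r, e' (tofrac r) = e r.
Proof.
move=> e_inj.
have ex (c : {fraction R}) : exists bd : R * R,
    bd.2 != 0 /\ c * tofrac bd.2 = tofrac bd.1.
  by have [b [d [d0 cdb]]] := tofrac_div c; exists (b, d).
pose e' c := e (sval (cid (ex c))).1 / e (sval (cid (ex c))).2.
have e0 r : r != 0 -> e r != 0 by apply: contra_neq; apply: e_inj.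
have e'E c b d : d != 0 -> c * tofrac d = tofrac b -> e' c = e b / e d.
  rewrite /e'; case: cid => -[b1 d1] /= [d10 cd1] d0 cd.
  apply/eqP; rewrite eqr_div ?e0 // -!rmorphM; apply/eqP; congr (e _).
  by apply/eqP; rewrite -tofrac_eq !tofracM -cd -cd1; apply/eqP; ring.
have e'r r : e' (tofrac r) = e r.
  by rewrite (e'E _ r 1) ?oner_neq0 ?rmorph1 ?divr1 ?mulr1.
have zm : zmod_morphism e'.
  move=> c1 c2; have [b1 [d1 [d10 cd1]]] := tofrac_div c1.
  have [b2 [d2 [d20 cd2]]] := tofrac_div c2.
  rewrite (e'E c1 b1 d1) // (e'E c2 b2 d2) //.
  rewrite (e'E _ (b1 * d2 - b2 * d1) (d1 * d2)) ?mulf_neq0 //.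
    by rewrite rmorphB !rmorphM; field; rewrite !e0.
  by rewrite tofracB !tofracM -cd1 -cd2; ring.
have mm : monoid_morphism e'.
  split=> [|c1 c2]; first by rewrite -tofrac1 e'r rmorph1.
  have [b1 [d1 [d10 cd1]]] := tofrac_div c1.
  have [b2 [d2 [d20 cd2]]] := tofrac_div c2.
  rewrite (e'E c1 b1 d1) // (e'E c2 b2 d2) //.
  rewrite (e'E _ (b1 * b2) (d1 * d2)) ?mulf_neq0 //.
    by rewrite !rmorphM; field; rewrite !e0.
  by rewrite !tofracM -cd1 -cd2; ring.
pose zmI := GRing.isZmodMorphism.Build _ _ e' zm.
pose mmI := GRing.isMonoidMorphism.Build _ _ e' mm.
pose e'' : {rmorphism {fraction R} -> L} := HB.pack e' zmI mmI.
by exists e''.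
Qed.

(** If r is coprime to a polynomial P killing v, Bezout inverts r(v); otherwise their gcd, nonzero
    at v since it divides r, is removed from P and the degree drops. *)
Lemma horner_map_inv (F L : fieldType) (e : {rmorphism F -> L}) (v : L)
    (r : {poly F}) :
  algebraicOver e v -> exists s, (map_poly e s).[v] = (map_poly e r).[v]^-1.
Proof.
have [->|rv0] := eqVneq (map_poly e r).[v] 0.
  (* The inverse of 0 is 0 by convention. *)
  by exists 0; rewrite rmorph0 horner0 invr0.
case=> P; have [n] := ubnP (size P); elim: n P => // n IHn P sP P0 Pv.
have dvd_nz d : d %| r -> (map_poly e d).[v] != 0.
  move/dvdpP => -[s rE]; move: rv0; rewrite rE rmorphM hornerM.
  by apply: contraNneq => ->; rewrite mulr0.
have [cop|ncop] := boolP (coprimep r P).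
  have [[u1 u2] /=] := Bezout_eq1_coprimepP _ _ cop.
  move=> /(congr1 (fun q => (map_poly e q).[v])).
  rewrite rmorphD !rmorphM rmorph1 /= hornerD !hornerM (rootP Pv) mulr0 addr0.
  rewrite hornerC => e1; exists u1.
  by apply: (mulIf rv0); rewrite e1 mulVf.
have := dvdp_gcdr r P => /dvdpP[s PE].
have gnz := dvd_nz _ (dvdp_gcdl r P).
have s0 : s != 0 by apply: contraNneq P0 => s0; rewrite PE s0 mul0r.
have g0 : gcdp r P != 0.
  by apply: contraNneq gnz => ->; rewrite rmorph0 horner0.
apply: (IHn s) => //.
  have := size_mul s0 g0; rewrite -PE => sPE.
  have : (1 < size (gcdp r P))%N.
    by rewrite ltn_neqAle eq_sym -/(coprimep r P) ncop size_poly_gt0.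
  move: sP; rewrite ltnS sPE; case: (size (gcdp r P)) => [|[|m]] // le_n _.
  by apply: leq_trans le_n; rewrite !addnS /= ltnS leq_addr.
move: Pv; rewrite {1}PE /root rmorphM hornerM mulf_eq0 (negPf gnz) orbF //.
Qed.

(** * Irreducibility of Artin-Schreier polynomials *)

Section ArtinSchreierIrreducible.
Variables (p : nat) (K L : fieldType) (e : {rmorphism K -> L}) (c : K) (v : L).
Hypothesis charK : p \in [pchar K].
Hypothesis vE : v ^+ p - v = e c.
Hypothesis cE : forall t : K, t ^+ p - t <> c.

Let p_pr : prime p := pcharf_prime charK.
Let p_gt1 : (1 < p)%N := prime_gt1 p_pr.

Definition artin_schreier_poly : {poly K} := 'X^p - 'X - c%:P.

Lemma size_artin_schreier_poly : size artin_schreier_poly = p.+1.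
Proof.
rewrite /artin_schreier_poly -addrA size_polyDl size_polyXn // -opprD
  size_polyN.
by rewrite ltnS size_XaddC.
Qed.

Lemma root_artin_schreier_poly : root (map_poly e artin_schreier_poly) v.
Proof.
rewrite /root /artin_schreier_poly !rmorphB /= map_polyXn map_polyX map_polyC.
by rewrite !hornerE vE subrr.
Qed.

(** In characteristic p, adding an element of the prime field to a root gives another root, and the
    [v + n] for n < p are p distinct ones. *)
Lemma artin_schreier_split : map_poly e artin_schreier_poly =
  \prod_(n < p) ('X - (v + n%:R)%:P).
Proof.
have charL : p \in [pchar L] by rewrite (fmorph_pchar e).
pose rs := [seq v + n%:R | n : 'I_p].
have -> : \prod_(n < p) ('X - (v + n%:R)%:P) = \prod_(z <- rs) ('X - z%:P).
  by rewrite big_map big_enum.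
rewrite [LHS](@all_roots_prod_XsubC _ _ rs).
- rewrite (_ : lead_coef _ = 1) ?scale1r // lead_coef_map.
  apply/eqP; rewrite fmorph_eq1 /artin_schreier_poly -addrA lead_coefDl
    ?lead_coefXn //.
  by rewrite size_polyXn -opprD size_polyN ltnS size_XaddC.
- by rewrite size_map_poly size_artin_schreier_poly size_map size_enum_ord.
- apply/allP => _ /mapP[n _ ->].
  rewrite /root /artin_schreier_poly !rmorphB /= map_polyXn map_polyX map_polyC.
  rewrite !hornerE (exprpD charL) -[n%:R ^+ p]/(pFrobenius_aut charL n%:R).
  by rewrite pFrobenius_aut_nat /= -vE; apply/eqP; ring.
- rewrite uniq_rootsE map_inj_uniq ?enum_uniq // => n1 n2 /addrI.
  wlog le12 : n1 n2 / (n1 <= n2)%N.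
    by move=> W; have [/W//|/ltnW/W{}W /esym/W/esym] := leqP n1 n2.
  move/eqP; rewrite eq_sym -subr_eq0 -natrB // -(dvdn_pcharf charL).
  move=> dv; apply/val_inj/eqP; rewrite eqn_leq le12 -subn_eq0 /=.
  by apply: contraLR dv; rewrite -lt0n => n0;
    rewrite gtnNdvd // (leq_ltn_trans (leq_subr _ _)).
Qed.

(* The sum of the roots of a proper factor is an integer multiple, prime to
   [p], of [v] plus an integer, which would put [v] in [K]. *)
Lemma artin_schreier_irreducible : irreducible_poly artin_schreier_poly.
Proof.
split=> [|d d1 dvd]; first by rewrite size_artin_schreier_poly ltnS prime_gt0.
have m0 : artin_schreier_poly != 0.
  by rewrite -size_poly_gt0 size_artin_schreier_poly.
have d0 := dvdpN0 dvd m0.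
rewrite -dvdp_size_eqp // size_artin_schreier_poly.
pose d' := (lead_coef d)^-1 *: d.
have ld0 : lead_coef d != 0 by rewrite lead_coef_eq0.
have d'm : d' \is monic by rewrite monicE lead_coefZ mulVf.
have sd' : size d' = size d by rewrite size_scale // invr_eq0.
have : map_poly e d' %| \prod_(n < p) ('X - (v + n%:R)%:P).
  by rewrite -artin_schreier_split dvdp_map dvdpZl // invr_eq0.
case/dvdp_prod_XsubC => msk; rewrite eqp_monic ?map_monic ?monic_prod_XsubC //.
set s := mask _ _ => /eqP d'E.
have us : size s = (size d).-1.
  have := congr1 (fun q : {poly L} => (size q).-1) d'E.
  by rewrite size_map_poly sd' size_prod_XsubC.
have s_le : (size s <= p)%N.
  have := dvdp_leq m0 dvd; rewrite size_artin_schreier_poly us.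
  by rewrite -subn1 leq_subLR.
have d_gt1 : (1 < size d)%N by rewrite ltn_neqAle eq_sym d1 size_poly_gt0.
rewrite -(ltn_predK d_gt1) eqSS -us eqn_leq s_le /= leqNgt; apply/negP => s_lt.
have s_gt0 : (0 < size s)%N by rewrite us; lia.
have sum_v : \sum_(n <- s) (v + n%:R) = e (- d'`_(size s).-1).
  rewrite rmorphN -coef_map d'E.
  have := @coefPn_prod_XsubC L [seq v + n%:R | n : 'I_p <- s].
  rewrite size_map -lt0n => /(_ s_gt0); rewrite !big_map => ->.
  by rewrite opprK.
have sK : (size s)%:R != 0 :> K by rewrite -(dvdn_pcharf charK) gtnNdvd.
pose N := \sum_(n <- s) (nat_of_ord n).
have vK : v = e ((- d'`_(size s).-1 - N%:R) / (size s)%:R).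
  rewrite fmorph_div rmorphB -sum_v !rmorph_nat big_split /= -natr_sum addrK.
  rewrite big_const_seq count_predT iter_addr_0 -[v *+ _]mulr_natr mulfK //.
  by rewrite -(rmorph_nat e) fmorph_eq0.
apply: (cE (t := (- d'`_(size s).-1 - N%:R) / (size s)%:R)).
by apply: (fmorph_inj e); rewrite rmorphB rmorphXn /= -vK.
Qed.

End ArtinSchreierIrreducible.

(** Writing t = b/d turns the equation into b^p - b d^(p-1) = g d^p. If deg b <= deg d, the right
    side has larger degree; otherwise the left side has degree p deg b, which forces p to divide deg
    g. *)
Lemma fraction_artin_schreier (p : nat) (F : fieldType) (g : {poly F}) :
    p \in [pchar F] -> ~~ (p %| (size g).-1)%N ->
  forall t : {fraction {poly F}}, t ^+ p - t <> tofrac g.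
Proof.
move=> charF pg t tE; have p_pr := pcharf_prime charF.
have p0 := prime_gt0 p_pr.
have [b [d [d0 tdb]]] := tofrac_div t.
have g_nz : g != 0 by apply: contraNneq pg => ->; rewrite size_poly0 dvdn0.
have bE : b ^+ p - b * d ^+ p.-1 = g * d ^+ p.
  apply/eqP; rewrite -tofrac_eq tofracB !tofracM !tofracXn -tE -tdb.
  rewrite exprMn mulrBl; apply/eqP; congr (_ - _).
  by rewrite -[in RHS](prednK p0) exprS mulrA.
have sd k : (size (d ^+ k)).-1 = ((size d).-1 * k)%N := size_exp d k.
have d_gt0 : (0 < size d)%N by rewrite size_poly_gt0.
have b0 : b != 0.
  apply/eqP => b0; move: bE; rewrite b0 expr0n gtn_eqF // mul0r subrr =>
    /esym/eqP.
  by rewrite mulf_eq0 (negPf g_nz) expf_eq0 (negPf d0) andbF.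
have degM (q1 q2 : {poly F}) : q1 != 0 -> q2 != 0 ->
    (size (q1 * q2)).-1 = ((size q1).-1 + (size q2).-1)%N.
  move=> q10 q20; rewrite size_mul //.
  move: q10 q20; rewrite -!size_poly_gt0.
  by case: (size q1) (size q2) => [|m1] [|m2] // _ _; rewrite addnS.
have s1 : (size (g * d ^+ p)).-1 = ((size g).-1 + (size d).-1 * p)%N.
  by rewrite degM ?expf_neq0 // sd.
have s2 : (size (b * d ^+ p.-1)).-1 = ((size b).-1 + (size d).-1 * p.-1)%N.
  by rewrite degM ?expf_neq0 // sd.
have s3 : (size (b ^+ p)).-1 = ((size b).-1 * p)%N := size_exp b p.
have gd : (0 < (size g).-1)%N by rewrite lt0n; apply: contraNneq pg => ->.
set B := (size b).-1 in s2 s3 *; set D := (size d).-1 in s1 s2 *.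
have mulp k : (k * p = k + k * p.-1)%N by rewrite -mulnS prednK.
have [le_bd|lt_db] := leqP (size b) (size d).
  have le_BD : (B <= D)%N by rewrite /B /D -!subn1 leq_sub2r.
  have s2' : ((size (b * d ^+ p.-1)%R).-1 <= D * p)%N by rewrite s2 mulp
    leq_add2r.
  have s3' : ((size (b ^+ p)).-1 <= D * p)%N by rewrite s3 leq_mul2r le_BD orbT.
  have := size_polyD (b ^+ p) (- (b * d ^+ p.-1)); rewrite size_polyN bE.
  move: s1 s2' s3' gd.
  move: (D * p)%N (size (g * _)) (size (b * _)) (size (b ^+ p)) ((size g).-1).
  by clear; move=> k u1 u2 u3 u4; lia.
have lt_DB : (D < B)%N by rewrite /B /D; move: lt_db d_gt0; clear;
  case: (size b) (size d) => [|m1] [|m2].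
have sb : (size (b ^+ p - b * d ^+ p.-1)).-1 = (B * p)%N.
  rewrite size_polyDl // size_polyN.
  have : ((size (b * d ^+ p.-1)%R).-1 < (size (b ^+ p)).-1)%N.
    rewrite s2 s3 mulp ltn_add2l ltn_mul2r lt_DB andbT.
    by rewrite -subn1 subn_gt0 prime_gt1.
  by move: (size (b * _)) (size (b ^+ p)); clear; lia.
move: s1; rewrite -bE sb => e.
case/negP: pg; have := dvdn_mull B (dvdnn p).
by rewrite e dvdn_addl // dvdn_mull.
Qed.

Lemma transcendental_horner_eq0 (F L : fieldType) (J : {rmorphism F -> L}) (x :
  L)
    (q : {poly F}) :
  ~ algebraicOver J x -> (map_poly J q).[x] = 0 -> q = 0.
Proof.
move=> xJ q0; apply: contrapT => /eqP qn0; apply: xJ; exists q => //.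
by apply/rootP.
Qed.

Lemma transcendental_horner_inj (F L : fieldType) (J : {rmorphism F -> L}) (x :
  L)
    (q1 q2 : {poly F}) :
  ~ algebraicOver J x -> (map_poly J q1).[x] = (map_poly J q2).[x] -> q1 = q2.
Proof.
move=> xJ q12; apply/eqP; rewrite -subr_eq0; apply/eqP.
by apply: (transcendental_horner_eq0 xJ); rewrite rmorphB hornerD hornerN q12
  subrr.
Qed.

Lemma rational_functions_embed (F L : fieldType) (J : {rmorphism F -> L}) (x :
  L) :
    ~ algebraicOver J x ->
  exists e : {rmorphism {fraction {poly F}} -> L},
    forall q, e (tofrac q) = (map_poly J q).[x].
Proof.
move=> xJ; pose ev : {rmorphism {poly F} -> L} := horner_eval x \o map_poly J.
have [e eE] := @fraction_lift _ _ ev (fun q => @transcendental_horner_eq0 _ _ _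
  _ q xJ).
by exists e.
Qed.

(* Both function fields contain a copy of [F(X)] over which [v] and [y] are
   roots of the same irreducible polynomial. *)
Lemma AS_function_field_embed (p : nat) (F K L : fieldType)
    (j : {rmorphism F -> K}) (J : {rmorphism F -> L}) (g : {poly F})
    (u v : K) (x y : L) :
    p \in [pchar F] -> ~~ (p %| (size g).-1)%N ->
    AS_function_field p j g u v ->
    ~ algebraicOver J x -> y ^+ p - y = (map_poly J g).[x] ->
  exists phi : {rmorphism K -> L},
    [/\ forall t, phi (j t) = J t, phi u = x & phi v = y].
Proof.
move=> charF pg [uj vE genK] xJ yE.
have [e1 e1E] := rational_functions_embed uj.
have [e2 e2E] := rational_functions_embed xJ.
have charK0 : p \in [pchar {fraction {poly F}}].
  rewrite inE (pcharf_prime charF) /= -tofrac1 -tofracMn tofrac_eq0.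
  by rewrite (pcharf0 (charKX charF)).
pose m := artin_schreier_poly p (tofrac g : {fraction {poly F}}).
have e1v : root (map_poly e1 m) v by apply: root_artin_schreier_poly;
  rewrite vE e1E.
have e2y : root (map_poly e2 m) y by apply: root_artin_schreier_poly;
  rewrite yE e2E.
have irr : irreducible_poly m.
  apply: (@artin_schreier_irreducible _ _ _ e1 _ v) => //;
    first by rewrite vE e1E.
  exact: fraction_artin_schreier.
(* [m] is the minimal polynomial of [v]: a polynomial not divisible by it is coprime to it, and
   Bezout at v would give 0 = 1. *)
have m_dvd (r : {poly {fraction {poly F}}}) : (map_poly e1 r).[v] = 0 -> m %| r.
  move=> rv; have [//|nmr] := boolP (m %| r).
  have cop : coprimep r m.
    apply: contraT; rewrite /coprimep => g1.
    have /eqp_dvdl gm := irr.2 _ g1 (dvdp_gcdr _ _).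
    by move: nmr; rewrite -gm dvdp_gcdl.
  have [[u1 u2] /=] := Bezout_eq1_coprimepP _ _ cop.
  move=> /(congr1 (fun q => (map_poly e1 q).[v])).
  rewrite rmorphD !rmorphM rmorph1 /= hornerD !hornerM rv (rootP e1v) !mulr0
    addr0.
  by rewrite hornerC => /eqP; rewrite eq_sym oner_eq0.
have alg_v : algebraicOver e1 v.
  by exists m => //; rewrite -size_poly_gt0; case: irr => /ltnW.
have ex z : exists r : {poly {fraction {poly F}}}, (map_poly e1 r).[v] = z.
  have sub : adjoin2 j u v `<=`
      [set w | exists r : {poly {fraction {poly F}}}, (map_poly e1 r).[v] = w].
    apply: adjoin2_ind => [t|||_ _ [r1 <-] [r2 <-]|_ _ [r1 <-] [r2 <-]].
    - by exists (tofrac t%:P)%:P; rewrite map_polyC hornerC /= e1E map_polyC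
      hornerC.
    - by exists (tofrac 'X)%:P; rewrite map_polyC hornerC /= e1E map_polyX
      hornerX.
    - by exists 'X; rewrite map_polyX hornerX.
    - by exists (r1 - r2); rewrite rmorphB hornerD hornerN.
    - have [s sE] := horner_map_inv r2 alg_v.
      by exists (r1 * s); rewrite rmorphM hornerM sE.
  by apply: sub; rewrite genK.
(* The value does not depend on the chosen polynomial in v, since two choices differ by a multiple
   of m, which vanishes at y. *)
pose f z := (map_poly e2 (sval (cid (ex z)))).[y].
have fE r : f (map_poly e1 r).[v] = (map_poly e2 r).[y].
  rewrite /f; case: cid => r' /= r'r; apply/eqP; rewrite -subr_eq0.
  have /dvdpP[s sE] : m %| r' - r.
    by apply: m_dvd; rewrite rmorphB hornerD hornerN r'r subrr.
  by rewrite -hornerN -hornerD -rmorphB sE rmorphM hornerM (rootP e2y) mulr0.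
have zm : zmod_morphism f.
  move=> z1 z2; have [r1 <-] := ex z1; have [r2 <-] := ex z2.
  by rewrite -hornerN -hornerD -rmorphB !fE rmorphB hornerD hornerN.
have mm : monoid_morphism f.
  split=> [|z1 z2].
    have := fE 1; rewrite !rmorph1 !hornerC //.
  have [r1 <-] := ex z1; have [r2 <-] := ex z2.
  by rewrite -hornerM -rmorphM !fE rmorphM hornerM.
pose zmI := GRing.isZmodMorphism.Build _ _ f zm.
pose mmI := GRing.isMonoidMorphism.Build _ _ f mm.
pose phi : {rmorphism K -> L} := HB.pack f zmI mmI.
exists phi; split=> [t||].
- have := fE (tofrac t%:P)%:P.
  by rewrite !map_polyC !hornerC /= e1E e2E !map_polyC !hornerC.
- have := fE (tofrac 'X)%:P.
  by rewrite !map_polyC !hornerC /= e1E e2E !map_polyX !hornerX.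
- by have := fE 'X; rewrite !map_polyX !hornerX.
Qed.

(** * The group P over the field of definition *)

(** X^p - X splits as the product of the X - n for n < p. *)
Lemma prime_subfieldP (p : nat) (K : fieldType) (z : K) :
  p \in [pchar K] -> z ^+ p = z -> exists n : nat, z = n%:R.
Proof.
move=> charK zp; have p0 := prime_gt0 (pcharf_prime charK).
have split0 := @artin_schreier_split p K K idfun 0 0 charK.
have /eqP : (map_poly idfun (artin_schreier_poly p (0 : K))).[z] = 0.
  by rewrite map_poly_id // /artin_schreier_poly !hornerE zp subrr subr0.
rewrite split0 ?expr0n ?gtn_eqF ?subr0 // horner_prod => /prodf_eq0[n _].
by rewrite hornerXsubC subr_eq0 add0r => /eqP ->; exists n.
Qed.

Lemma descend_poly (K k : fieldType) (iota : {rmorphism K -> k}) (q : {poly k})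
  :
  (forall j, exists t, q`_j = iota t) -> exists q', q = map_poly iota q'.
Proof.
elim/poly_ind: q => [|q c IHq] coefq; first by exists 0; rewrite rmorph0.
have [j|q' ->] := IHq.
  by have [t tE] := coefq j.+1; exists t; rewrite -tE coefD coefMX coefC addr0.
have [t] := coefq 0%N; rewrite coefD coefMX coefC add0r /= => ->.
by exists (q' * 'X + t%:P); rewrite rmorphD rmorphM /= map_polyX map_polyC.
Qed.

Lemma automorphism_rmorphism (k L : fieldType) (i : {rmorphism k -> L}) (s : L
  -> L) :
  is_automorphism i s -> exists s' : {rmorphism L -> L}, s = s'.
Proof.
case=> _ zm mm _.
pose zmI := GRing.isZmodMorphism.Build _ _ s zm.
pose mmI := GRing.isMonoidMorphism.Build _ _ s mm.
by pose s' : {rmorphism L -> L} := HB.pack s zmI mmI; exists s'.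
Qed.

Section Pullback.
Variables (p h : nat) (K : fieldType) (k : fieldType) (iota : {rmorphism K ->
  k}).
Variables (L : fieldType) (i : {rmorphism k -> L}) (x y : L).
Variable a : 'I_h.+1 -> K.
Hypothesis charK : p \in [pchar K].
Hypothesis odd_p : odd p.
Let ak m := iota (a m).
Hypothesis rootsE : forall w, root (polyE p ak) w -> exists w', w = iota w'.
Hypothesis genL : AS_function_field p i ('X * polyR p ak) x y.

Let p_pr : prime p := pcharf_prime charK.
Let J : {rmorphism K -> L} := i \o iota.
Let R := polyR p a.
Let P := groupP p ak i x y.

Let RkE : polyR p ak = map_poly iota R.
Proof. by rewrite map_polyR. Qed.

Lemma pullback_transcendental : ~ algebraicOver J x.
Proof.
case: genL => xi _ _ [q q0 qx]; apply: xi; exists (map_poly iota q).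
  by rewrite map_poly_eq0.
by rewrite -map_poly_comp.
Qed.
Let xJ := pullback_transcendental.

Lemma pullback_equation : y ^+ p - y = (map_poly J ('X * R)).[x].
Proof.
case: genL => _ -> _; rewrite RkE -[in LHS](map_polyX iota) -rmorphM /=.
by rewrite -map_poly_comp.
Qed.

(** The polynomial [g] stands for b + B_c, so an element of P is recorded by [c] and one polynomial,
    both over [K]. *)
Definition pullback (s : L -> L) (c : K) (g : {poly K}) : Prop :=
  [/\ is_automorphism i s, s x = x + J c & s y = y + (map_poly J g).[x]].

Lemma pullbackJ s c g t : pullback s c g -> s (J t) = J t.
Proof. by case=> -[_ _ _ si] _ _; apply: si. Qed.

Lemma pullback_horner s c g q : pullback s c g ->
  s (map_poly J q).[x] = (map_poly J (translate c q)).[x].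
Proof.
move=> sg; have [sA sx _] := sg.
have [s' s'E] := automorphism_rmorphism sA.
have sJ t : s' (J t) = J t by rewrite -s'E (pullbackJ _ sg).
rewrite s'E -horner_map -map_poly_comp -s'E sx map_translate translateE.
congr (_.[_]); apply: eq_map_poly => t /=; exact: sJ.
Qed.

(** This composition law is the source of the cocycle relation. *)
Lemma pullback_comp s t c d g g' : pullback s c g -> pullback t d g' ->
  is_automorphism i (s \o t) -> pullback (s \o t) (c + d) (g + translate c g').
Proof.
move=> sg tg st; split; rewrite // [LHS]/=; have [sA sx sy] := sg;
  have [_ tx ty] := tg.
  have [s' s'E] := automorphism_rmorphism sA.
  rewrite tx s'E rmorphD -s'E sx (pullbackJ _ sg).
  by rewrite rmorphD addrA.
have [s' s'E] := automorphism_rmorphism sA.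
rewrite ty s'E rmorphD -s'E sy (pullback_horner _ sg).
by rewrite rmorphD hornerD addrA.
Qed.

Lemma pullback_uniq s c d g g' :
  pullback s c g -> pullback s d g' -> c = d /\ g = g'.
Proof.
case=> _ sx sy [_ sx' sy']; split.
  by apply: (fmorph_inj J); apply: (addrI x); rewrite -sx.
by apply: (transcendental_horner_inj xJ); apply: (addrI y); rewrite -sy.
Qed.

Lemma pullback_ext s t c g : pullback s c g -> pullback t c g -> s = t.
Proof.
case=> sA sx sy [tA tx ty]; apply/funext => z.
have [_ _ _ si] := sA; have [_ _ _ ti] := tA.
have [s' s'E] := automorphism_rmorphism sA.
have [t' t'E] := automorphism_rmorphism tA.
have sub : adjoin2 i x y `<=` [set z | s z = t z].
  apply: adjoin2_ind => [u|||u w|u w] /=.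
  - by have := si u; have := ti u; rewrite /= => -> ->.
  - by rewrite sx.
  - by rewrite sy.
  - by rewrite s'E t'E !rmorphB => -> ->.
  - by rewrite s'E t'E !fmorph_div => -> ->.
by apply: sub; case: genL => _ _ ->.
Qed.

Lemma groupP_automorphism s : P s -> is_automorphism i s.
Proof. by case=> b [c [_ _ []]]. Qed.

(* As [B(c) / 2] solves [b ^+ p - b = c R(c)], any other solution differs from
   it by an element of the prime field, hence lies in [K] too. *)
Lemma groupP_pullback s : P s -> exists c g b, [/\ pullback s c g,
  g ^+ p - g = translate c ('X * R) - 'X * R,
  root (polyE p ak) (iota c) & is_sigma p ak i x y b (iota c) s].
Proof.
case=> b [c0 [c0W bE sg]]; have [c cE] := rootsE c0W.
move: c0W bE sg; rewrite {c0}cE => cW bE sg.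
have [sA sx [B [B0 BE] sy]] := sg.
have chark : p \in [pchar k] by rewrite (fmorph_pchar iota).
(* The coefficients of B are determined from the bottom: the one of index j is the p-th power of
   that of index j/p, when p divides j, minus a coefficient over [K]. *)
have coefB j : exists t, B`_j = iota t.
  have [n] := ubnP j; elim: n j => // n IHn [|j]; rewrite ltnS => lejn.
    by exists 0; rewrite rmorph0.
  have : (B ^+ p - B)`_j.+1 = iota (c *: R + R.[c] *: 'X)`_j.+1.
    rewrite BE RkE horner_map -coef_map rmorphD /= !map_polyZ map_polyX.
    by [].
  rewrite coefB (coef_exprp chark); case: ifP => [pj|_].
    have [|t ->] := IHn (j.+1 %/ p)%N.
      by apply: leq_trans lejn; rewrite ltn_Pdiv // prime_gt1.
    move=> e1; exists (t ^+ p - (c *: R + R.[c] *: 'X)`_j.+1).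
    by rewrite rmorphB rmorphXn -e1 /=; ring.
  move=> e1; exists (- (c *: R + R.[c] *: 'X)`_j.+1).
  by rewrite rmorphN -e1 /=; ring.
have [B' B'E] := descend_poly coefB.
have two_neq0 : 2 != 0 :> k by rewrite -(dvdn_pcharf chark) gtnNdvd //
  odd_prime_gt2.
have half : (2^-1 : k) ^+ p = 2^-1.
  by rewrite exprVn -[2 ^+ p]/(pFrobenius_aut chark 2) pFrobenius_aut_nat.
have Rc : (polyR p ak).[iota c] = iota R.[c] by rewrite RkE horner_map.
have [n nE] : exists n : nat, b - B.[iota c] / 2 = n%:R.
  apply: (prime_subfieldP chark).
  rewrite (exprpD chark) (exprpN chark) exprMn half.
  have := congr1 (horner^~ (iota c)) BE; rewrite !hornerE Rc => BcE.
  have -> : B.[iota c] ^+ p = iota c * iota R.[c] + iota R.[c] * iota c +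
    B.[iota c].
    by rewrite -BcE; ring.
  have -> : b ^+ p = iota c * iota R.[c] + b by rewrite -Rc -bE; ring.
  by field.
pose b' := B'.[c] / 2 + n%:R.
have b'E : b = iota b'.
  rewrite rmorphD fmorph_div !rmorph_nat -horner_map -B'E -nE; ring.
exists c, (b'%:P + B'), b; split=> //.
  split=> //; rewrite sy b'E [map_poly _ (_ + _)]rmorphD /= map_polyC hornerD
    hornerC B'E addrA.
  by rewrite -map_poly_comp.
have map_inj := map_inj_poly (fmorph_inj iota) (rmorph0 iota).
apply: map_inj; rewrite !rmorphB rmorphXn rmorphD /= map_translate.
rewrite rmorphM /= map_polyX map_polyC /= -B'E -b'E -RkE rmorphM /= translateX.
rewrite (artin_schreierD (charKX chark)) BE -polyC_exp -polyCB bE.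
rewrite translate_polyR // -!mul_polyC polyCM; ring.
Qed.

(** With c = 0 the polynomial satisfies g^p = g, so it is constant and fixed by translations; both
    compositions with t then act alike on x and y. *)
Lemma pullback0_central s g : P s -> pullback s 0 g -> center P s.
Proof.
move=> Ps sg; split=> // t Pt.
have [c1 [g1 [b1 [sg1 g1E _ _]]]] := groupP_pullback Ps.
have [c1E g1E'] := pullback_uniq sg1 sg; move: g1E; rewrite {}c1E {}g1E'.
rewrite translate0 subrr => gE.
have [d [g' [b' [tg' _ _ _]]]] := groupP_pullback Pt.
have gC : translate d g = g.
  have g_le1 : (size g <= 1)%N.
    rewrite leqNgt; apply/negP => g_gt1; have := size_artin_schreier charK
      g_gt1.
    rewrite gE size_poly0 => /esym/eqP; rewrite muln_eq0 gtn_eqF ?prime_gt0 //=.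
    by rewrite -subn1 subn_eq0 leqNgt g_gt1.
  by rewrite (size1_polyC g_le1) translateC.
have cA u w : is_automorphism i u -> is_automorphism i w -> is_automorphism i
  (u \o w).
  move=> uA wA; have [ub _ _ ui] := uA; have [wb _ _ wi] := wA.
  have [u' u'E] := automorphism_rmorphism uA;
    have [w' w'E] := automorphism_rmorphism wA.
  split; first exact: bij_comp.
  - by move=> z1 z2; rewrite /= w'E u'E !rmorphB.
  - by split=> [|z1 z2]; rewrite /= w'E u'E ?rmorph1 ?rmorphM.
  - by move=> z; have := wi z; rewrite /= => ->; exact: ui.
have sA := groupP_automorphism Ps; have tA := groupP_automorphism Pt.
have st := pullback_comp sg tg' (cA _ _ sA tA).
have ts := pullback_comp tg' sg (cA _ _ tA sA).
apply: (pullback_ext st); move: ts.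
by rewrite translate0 gC addr0 add0r [g' + g]addrC.
Qed.

(** * The complement as a cocycle on its group of shifts *)

Section Complement.
Variables (AA A : set (L -> L)).
Hypothesis AA_sub : is_subgroup AA P.
Hypothesis A_sub : is_subgroup A AA.
Hypothesis A_card : (A #= `I_(p ^ h))%card.
Hypothesis A_center : A `&` center P = [set id].

Let AP s : A s -> P s.
Proof. by case: A_sub => sub _ _ _ /sub; case: AA_sub => + _ _ _; apply. Qed.

(** The quotient of two such elements has shift 0, so it is central and, lying in [A], trivial. *)
Lemma complement_inj s t c g g' : A s -> A t ->
  pullback s c g -> pullback t c g' -> s = t.
Proof.
move=> As At sg tg'; have [_ _ Acomp Ainv] := A_sub.
have [u Au ut] := Ainv t At.
have [d [gu [_ [ug _ _ _]]]] := groupP_pullback (AP Au).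
have autA w : A w -> is_automorphism i w by move/AP/groupP_automorphism.
have [_ idA _ _] := A_sub.
have id0 : pullback id 0 0.
  by split; rewrite ?rmorph0 ?addr0 ?horner0 ?addr0 //; apply: autA.
have utg := pullback_comp ug tg' (autA _ (Acomp _ _ Au At)).
have dc : d + c = 0.
  by rewrite ut in utg; have [] := pullback_uniq utg id0.
have usg := pullback_comp ug sg (autA _ (Acomp _ _ Au As)).
rewrite dc in usg.
have us : u \o s = id.
  have : (A `&` center P) (u \o s).
    split; first exact: Acomp.
    by apply: pullback0_central usg; apply: AP; apply: Acomp.
  by rewrite A_center.
have [[u1 uK _] _ _ _] := autA _ Au.
apply/funext => z; apply: (can_inj uK).
by have := congr1 (@^~ z) us; have := congr1 (@^~ z) ut; rewrite /= => -> ->.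
Qed.

(** By [complement_inj] the shifts of the p^h elements of [A] are distinct, so [A] is the graph of a
    function [g] on the group [V] they form. *)
Lemma complement_shifts : exists V : seq K, exists g : K -> {poly K},
  [/\ additive_seq V, size V = (p ^ h)%N,
      (forall s, A s -> exists2 c, c \in V & pullback s c (g c)) &
      (forall c, c \in V -> exists2 s, A s & pullback s c (g c))].
Proof.
have [_ Aid Acomp Ainv] := A_sub.
have /card_set_bijP[f' [f'A f'_inj f'_surj]] := A_card.
have f'ex n : exists s, (n < p ^ h)%N -> A s /\ f' s = n.
  have [ln|ln] := ltnP n (p ^ h); last by exists id.
  by have [s As sn] := f'_surj n ln; exists s.
have [f fE] := choice f'ex.
have fA n : (n < p ^ h)%N -> A (f n) by move=> /fE[].
have f_surj s : A s -> exists2 n, (n < p ^ h)%N & f n = s.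
  move=> As; have ln := f'A s As; exists (f' s) => //.
  by have [Afs fs] := fE _ ln; apply: f'_inj; rewrite ?inE.
have ex n : exists cg : K * {poly K}, (n < p ^ h)%N -> pullback (f n) cg.1 cg.2.
  have [ln|ln] := ltnP n (p ^ h); last by exists (0, 0).
  have [c [g [_ [fg _ _ _]]]] := groupP_pullback (AP (fA _ ln)).
  by exists (c, g).
have [cg cgE] := choice ex.
pose V := [seq (cg n).1 | n <- seq.iota 0 (p ^ h)].
have VP c : c \in V -> exists n, [/\ (n < p ^ h)%N, c = (cg n).1 & pullback (f
  n) c (cg n).2].
  case/mapP=> n; rewrite mem_iota add0n => ln ->; exists n; split=> //;
    exact: cgE.
have PV s c g : A s -> pullback s c g -> c \in V.
  move=> As sg; have [n ln fs] := f_surj s As.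
  have := cgE n ln; rewrite fs => sg'; have [-> _] := pullback_uniq sg sg'.
  by apply: map_f; rewrite mem_iota add0n.
have exg c : exists g, c \in V -> exists2 s, A s & pullback s c g.
  have [Vc|nVc] := boolP (c \in V); last by exists 0.
  have [n [ln cE fg]] := VP c Vc; exists (cg n).2 => _; exists (f n) => //.
  exact: fA.
have [g gE] := choice exg.
exists V, g; split=> // [||s As].
- split.
  + rewrite map_inj_in_uniq ?iota_uniq // => n1 n2.
    rewrite !mem_iota !add0n => l1 l2 e12.
    have [_ <-] := fE _ l1; have [_ <-] := fE _ l2; congr (f' _).
    apply: (complement_inj (fA _ l1) (fA _ l2) (cgE _ l1)).
    by rewrite e12; apply: cgE.
  + apply: (PV id 0 0) => //; split; rewrite ?rmorph0 ?addr0 ?horner0 ?addr0 //.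
    by apply: groupP_automorphism; apply: AP.
  + move=> c d Vc Vd; have [s As sg] := gE c Vc; have [t At tg] := gE d Vd.
    apply: (PV (s \o t)); first exact: Acomp.
    apply: pullback_comp sg tg _.
    by apply: groupP_automorphism; apply: AP; apply: Acomp.
- by rewrite size_map size_iota.
- have [c [g' [_ [sg' _ _ _]]]] := groupP_pullback (AP As).
  have Vc := PV _ _ _ As sg'; exists c => //.
  have [t At tg] := gE c Vc.
  by rewrite (complement_inj As At sg' tg).
Qed.

End Complement.

(** * The field of invariants of the complement *)

Section Quotient.
Variables (A : set (L -> L)) (V : seq K) (g : K -> {poly K}) (q : {poly K}).
Hypothesis aV : additive_seq V.
Hypothesis AV : forall s, A s -> exists2 c, c \in V & pullback s c (g c).
Hypothesis VA : forall c, c \in V -> exists2 s, A s & pullback s c (g c).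
Hypothesis qV : forall c, c \in V -> translate c q = q - g c.
Let f := annihilator V.

(** An element of [AA] commutes with [A]; evaluating both compositions at y gives the hypothesis of
    [commuting_shift], so its shift is in [V]. Conversely [V] comes from [A], contained in [AA]. *)
Lemma imageW_complement (AA : set (L -> L)) (al be : K) :
    size V = (p ^ h)%N -> al != 0 ->
    'X * R + (q ^+ p - q) = al *: f ^+ 2 + be *: f ->
    AA `<=` P -> is_abelian AA -> A `<=` AA ->
  imageW p ak i x y AA = [set` map iota V].
Proof.
move=> sV al0 qE AAP AAab AAA; apply/seteqP; split=> c /=.
  case=> _ [b [s [AAs sg]]].
  have [c' [g' [b' [sg' g'E _ _]]]] := groupP_pullback (AAP _ AAs).
  have -> : c = iota c'.
    have [_ sx _] := sg; have [_ sx' _] := sg'.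
    by apply: (fmorph_inj i); apply: (addrI x); rewrite -sx sx'.
  apply: map_f; apply: (commuting_shift charK odd_p aV sV qE al0 qV g'E) => d
    Vd.
  have [t At tg] := VA Vd.
  have st := AAab _ _ AAs (AAA _ At).
  have [_ sx sy] := sg'; have [_ tx ty] := tg.
  apply: (transcendental_horner_inj xJ); apply: (addrI y).
  rewrite !rmorphD !hornerD.
  have := congr1 (@^~ y) st; rewrite /= ty sy.
  have [s' s'E] := automorphism_rmorphism (groupP_automorphism (AAP _ AAs)).
  have [t' t'E] := automorphism_rmorphism (groupP_automorphism (AAP _ (AAA _
    At))).
  rewrite {1}s'E rmorphD -s'E sy (pullback_horner _ sg').
  rewrite {1}t'E rmorphD -t'E ty (pullback_horner _ tg) => stE.
  rewrite [X in _ + X]addrC addrA -stE; ring.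
case/mapP=> c' Vc' ->; have [s As sg] := VA Vc'.
have [c1 [g' [b [sg' _ cW ss]]]] := groupP_pullback (AAP _ (AAA _ As)).
have [cc _] := pullback_uniq sg' sg; rewrite -cc.
by split=> //; exists b, s; split=> //; apply: AAA.
Qed.

(* Over the image of [phi], every element of [K(x, y)] is a polynomial in [x]
   of size at most [size V]; if it is invariant, it takes the same value at the
   [size V] conjugates of [x], so it is constant. *)
Lemma range_invariants (M : fieldType) (j : {rmorphism K -> M}) (u v : M)
    (phi : {rmorphism M -> L}) (e z t : K) :
    t != 0 -> adjoin2 j u v = setT ->
    (forall r, phi (j r) = J r) ->
    phi u = (map_poly J (t^-1 *: (f + e%:P))).[x] ->
    phi v = y + (map_poly J (q + z%:P)).[x] ->
  range phi = invariants A (adjoin2 J x y).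
Proof.
move=> t0 genM phij phiu phiv; have [uV V0 _] := aV.
have fix_phi s c w : c \in V -> pullback s c (g c) -> s (phi w) = phi w.
  move=> Vc sg; have [sA sx sy] := sg.
  have [s' s'E] := automorphism_rmorphism sA.
  have sub : adjoin2 j u v `<=` [set w | s (phi w) = phi w].
    apply: adjoin2_ind => [r|||w1 w2|w1 w2] /=.
    - by rewrite phij (pullbackJ _ sg).
    - rewrite phiu (pullback_horner _ sg) /translate comp_polyZ.
      rewrite -/(translate c _) rmorphD /= translateC.
      by rewrite translate_annihilator.
    - rewrite phiv {1}s'E rmorphD -s'E sy (pullback_horner _ sg).
      rewrite [translate c _]rmorphD /= translateC qV // -addrA; congr (y + _).
      by rewrite -hornerD -rmorphD; congr ((map_poly _ _).[_]); ring.
    - by rewrite !rmorphB s'E rmorphB -s'E => -> ->.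
    - by rewrite !fmorph_div s'E fmorph_div -s'E => -> ->.
  by apply: sub; rewrite genM.
have phi_map r : map_poly phi (map_poly j r) = map_poly J r.
  by rewrite -map_poly_comp; apply: eq_map_poly => w /=; apply: phij.
apply/seteqP; split=> [_ [w _ <-]|w [Mw inv_w]].
  split=> [|s /AV[c Vc sg]]; last exact: fix_phi sg.
  have sub : adjoin2 j u v `<=` [set w | adjoin2 J x y (phi w)].
    apply: adjoin2_ind => [r|||w1 w2|w1 w2] /=.
    - by rewrite phij; apply: adjoin2_base.
    - by rewrite phiu; apply: adjoin2_horner; apply: adjoin2_x.
    - rewrite phiv; apply: adjoin2D; first exact: adjoin2_y.
      by apply: adjoin2_horner; apply: adjoin2_x.
    - by rewrite rmorphB; apply: adjoin2B.
    - by rewrite fmorph_div; apply: adjoin2_div.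
  by apply: sub; rewrite genM.
(* As [u] maps to (f(x) + e) / t, the image of [m] is f(X) - f(x), which has x as a root. *)
pose m : {poly M} := map_poly j f - (j t * u - j e)%:P.
have V_gt0 : (0 < size V)%N by case: (V) V0.
have sm : size m = (size V).+1.
  rewrite size_polyDl size_map_poly size_annihilator // size_polyN.
  by rewrite (leq_ltn_trans (size_polyC_leq1 _)).
have m0 : m != 0 by rewrite -size_poly_gt0 sm.
have mx : (map_poly phi m).[x] = 0.
  rewrite rmorphB /= phi_map map_polyC hornerD hornerN hornerC /=.
  rewrite rmorphB rmorphM !phij phiu map_polyZ rmorphD /= map_polyC.
  rewrite hornerZ hornerD hornerC !fmorphV.
  by rewrite /= mulVKf ?fmorph_eq0 // addrK subrr.
have alg_x : algebraicOver phi x by exists m => //; apply/rootP.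
have sub : adjoin2 J x y `<=` [set w | exists r, (map_poly phi r).[x] = w].
  apply: adjoin2_ind => [r|||_ _ [r1 <-] [r2 <-]|_ _ [r1 <-] [r2 <-]].
  - by exists (j r)%:P; rewrite map_polyC hornerC /= phij.
  - by exists 'X; rewrite map_polyX hornerX.
  (* Here y is recovered as v - q(x) - z. *)
  - exists (v%:P - map_poly j (q + z%:P)).
    by rewrite rmorphB /= map_polyC phi_map hornerD hornerN hornerC /= phiv
      addrK.
  - by exists (r1 - r2); rewrite rmorphB hornerD hornerN.
  - have [s sE] := horner_map_inv r2 alg_x.
    by exists (r1 * s); rewrite rmorphM hornerM sE.
have [r0 r0w] := sub w Mw.
pose r := r0 %% m.
have rw : (map_poly phi r).[x] = w.
  rewrite -r0w [in RHS](divp_eq r0 m) rmorphD rmorphM hornerD hornerM mx mulr0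
    add0r.
  by [].
have sr : (size r <= size V)%N by rewrite -ltnS -sm ltn_modp.
have r_const : map_poly phi r - w%:P = 0.
  apply: (@roots_geq_poly_eq0 _ _ [seq x + J c | c <- V]).
  - apply/allP => _ /mapP[c Vc ->]; have [s As sg] := VA Vc.
    have [sA sx _] := sg; have [s' s'E] := automorphism_rmorphism sA.
    rewrite /root hornerD hornerN hornerC subr_eq0 -sx -[X in _ == X](inv_w s
      As).
    apply/eqP; rewrite -[in RHS]rw [in RHS]s'E -horner_map -map_poly_comp -s'E.
    congr (_.[_]); apply: eq_map_poly => w' /=; rewrite -s'E; symmetry.
    exact: fix_phi sg.
  - rewrite map_inj_uniq // => c d /addrI; exact: fmorph_inj.
  - rewrite size_map (leq_trans (size_polyD _ _)) // geq_max size_map_poly sr.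
    by rewrite size_polyN (leq_trans (size_polyC_leq1 _)).
exists r`_0 => //; move/eqP: r_const; rewrite subr_eq0 => /eqP.
by move/(congr1 (coefp 0)); rewrite /= coef_map coefC.
Qed.

End Quotient.
End Pullback.

(** * The isomorphism over the splitting field *)

Lemma transcendental_comp (F L : fieldType) (J : {rmorphism F -> L}) (x : L)
    (q : {poly F}) :
  ~ algebraicOver J x -> (1 < size q)%N -> ~ algebraicOver J (map_poly J q).[x].
Proof.
move=> xJ q1 [r r0 /rootP]; rewrite -horner_comp -map_comp_poly => rx.
have := transcendental_horner_eq0 xJ rx.
by move/eqP; rewrite comp_poly_eq0 // (negPf r0).
Qed.

(** Frobenius is injective on a finite set, hence onto. *)
Lemma finite_ext_perfect (p : nat) (F : finFieldType) (K : fieldExtType F) :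
  p \in [pchar K] -> forall z : K, exists t, t ^+ p = z.
Proof.
move=> charK z; pose f (w : finvect_type K) : finvect_type K := (w : K) ^+ p.
have f_inj : injective f by move=> w1 w2; apply: (fmorph_inj (pFrobenius_aut
  charK)).
by have [f' _ fK] := injF_bij f_inj; exists (f' z); apply: (fK z).
Qed.

Lemma map_nonzeros (K k : fieldType) (iota : {rmorphism K -> k}) (V : seq K) :
  map iota (nonzeros V) = nonzeros (map iota V).
Proof.
by rewrite /nonzeros filter_map; congr map; apply: eq_filter => c /=;
  rewrite fmorph_eq0.
Qed.

(* F = F_(p^r), Fq = splitting field of E over F, k = algebraic closure,
   L = k(x, y) = function field of C_R over k, and F_q(C_R) = Fq(x, y). *)
Theorem theorem7p4 (p r h : nat) (F : finFieldType) (a : 'I_h.+1 -> F)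
    (Fq : fieldExtType F) (k : closedFieldType) (iota : {rmorphism Fq -> k})
    (L : fieldType) (i : {rmorphism k -> L}) (x y : L)
    (AA A : set (L -> L)) :
  let ak := fun m => iota (in_alg Fq (a m)) in
  let P := groupP p ak i x y in
  prime p -> odd p -> #|F| = (p ^ r)%N ->
  a ord_max != 0 ->
  splittingFieldFor 1 (map_poly (in_alg Fq) (polyE p a)) {:Fq} ->
  (forall z : k, algebraicOver iota z) ->
  AS_function_field p i ('X * polyR p ak) x y ->
  is_max_abelian AA P ->
  is_subgroup A AA -> (A #= `I_(p ^ h))%card -> A `&` center P = [set id] ->
  exists2 alpha : Fq, iota alpha = coefA p ak i x y AA &
    forall (K : fieldType) (j : {rmorphism Fq -> K}) (u v : K),
      AS_function_field p j (alpha *: 'X^2) u v ->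
      curve_iso_onto j (i \o iota) (invariants A (adjoin2 (i \o iota) x y)).
Proof.
move=> ak P p_pr odd_p cardF ah0 splitE _ genL [AAP AAab _] A_sub A_card
  A_center.
have charF := card_finPcharP cardF p_pr.
have charFq : p \in [pchar Fq] by rewrite (fmorph_pchar (in_alg Fq)).
have two_neq0 : 2 != 0 :> Fq by rewrite -(dvdn_pcharf charFq) gtnNdvd //
  odd_prime_gt2.
pose aq m := in_alg Fq (a m).
(* [Fq] splits E, so every root of E in [k] comes from [Fq]. *)
have rootsE w : root (polyE p ak) w -> exists w', w = iota w'.
  case: splitE => rs splitE _.
  have -> : polyE p ak = map_poly iota (map_poly (in_alg Fq) (polyE p a)).
    by rewrite !map_poly_polyE.
  move: splitE; rewrite -(eqp_map iota) => /eqp_root -> /=.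
  rewrite rmorph_prod /=.
  under eq_bigr => c _ do rewrite rmorphB /= map_polyX map_polyC.
  rewrite -(big_map iota xpredT (fun c => 'X - c%:P)) root_prod_XsubC.
  by case/mapP=> w' _ ->; exists w'.
have [V [g [aV sV AV VA]]] :=
  complement_shifts charFq odd_p rootsE genL AAP A_sub A_card A_center.
have [AAsub _ _ _] := AAP; have [AAA _ _ _] := A_sub.
pose t := \prod_(c <- nonzeros V) c.
have t0 : t != 0 by apply: prod_nonzeros_neq0 odd_p aV sV.
have xJ := pullback_transcendental genL.
have gE c : c \in V ->
    g c ^+ p - g c = translate c ('X * polyR p aq) - 'X * polyR p aq.
  move=> Vc; have [s As sg] := VA c Vc.
  have [c1 [g1 [b [sg1 g1E _ _]]]] := groupP_pullback charFq odd_p rootsE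
    (AAsub _ (AAA _ As)).
  by have [<- <-] := pullback_uniq genL sg1 sg.
have gD c d : c \in V -> d \in V -> g (c + d) = translate d (g c) + g d.
  move=> Vc Vd; have [s As sg] := VA c Vc; have [w Aw wg] := VA d Vd.
  have [_ _ VD] := aV; have [s' As' sg'] := VA _ (VD _ _ Vd Vc).
  have [_ _ Acomp _] := A_sub.
  have Aws := Acomp _ _ Aw As.
  (* The product of the elements above d and c has shift d + c, so by [complement_inj] it is the
     chosen one, and the two polynomials agree. *)
  have wsg := pullback_comp wg sg (groupP_automorphism (AAsub _ (AAA _ Aws))).
  have e1 := complement_inj charFq odd_p rootsE genL AAP A_sub A_center As' Aws
    sg' wsg.
  rewrite e1 in sg'; have [_ e2] := pullback_uniq genL sg' wsg.
  by rewrite addrC e2 addrC.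
have perfFq := finite_ext_perfect charFq.
have [q [al [be [qV qE alE]]]] :=
  quotient_equation charFq odd_p aV sV perfFq gD gE.
set alpha := quotient_coef aq V in alE.
have alpha0 : alpha != 0.
  rewrite /alpha /quotient_coef; case: ifP => [/eqP h0|_].
    (* For h = 0 the coefficient is a_0, which is also the leading one. *)
    have -> : ord0 = ord_max :> 'I_h.+1 by apply: val_inj; rewrite /= h0.
    by rewrite fmorph_eq0.
  by rewrite mulf_neq0 // mulf_neq0 ?invr_eq0 // fmorph_eq0.
have al0 : al != 0 by apply: contraNneq alpha0 => al0; rewrite -alE al0 mul0r.
exists alpha.
  have imW := imageW_complement charFq odd_p rootsE genL aV VA qV sV al0 qE
    AAsub AAab AAA.
  rewrite /alpha /quotient_coef /coefA; case: ifP => // _.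
  rewrite rmorphM fmorph_div rmorph_nat; congr (_ * _).
  rewrite imW rmorph_prod /=.
  have -> : [set` map iota V] `\ 0 = [set` map iota (nonzeros V)].
    apply/seteqP; split=> c /=; rewrite map_nonzeros mem_filter.
      by case=> -> /eqP ->.
    by case/andP => /eqP c0 Vc; split.
  rewrite -fsbig_seq; first by rewrite big_map.
  by rewrite map_inj_uniq ?filter_uniq //; [case: aV | apply: fmorph_inj].
have [e [z [beE zE]]] := linear_term_removal charFq odd_p aV sV qE al0 rootsE.
move=> K j u v genK.
pose J : {rmorphism Fq -> L} := i \o iota.
have charL : p \in [pchar L] by rewrite (fmorph_pchar J).
pose f := annihilator V.
have sf : size (t^-1 *: (f + e%:P)) = (size V).+1.
  have V0 : (0 < size V)%N by rewrite sV expn_gt0 prime_gt0.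
  rewrite size_scale ?invr_eq0 // size_polyDl size_annihilator //.
  by rewrite (leq_ltn_trans (size_polyC_leq1 _)).
have x'J : ~ algebraicOver J (map_poly J (t^-1 *: (f + e%:P))).[x].
  by apply: transcendental_comp xJ _; rewrite sf ltnS sV expn_gt0 prime_gt0.
have palpha : ~~ (p %| (size (alpha *: 'X^2 : {poly Fq})).-1)%N.
  by rewrite size_scale // size_polyXn gtnNdvd // odd_prime_gt2.
have [_ _ genM] := genK.
(* With alpha = al t^2, be = 2 al e and z^p - z = al e^2, completing the square gives al (f + e)^2 =
   alpha ((f + e) / t)^2, so the new pair satisfies the target equation. *)
have [|phi [phij phiu phiv]] := AS_function_field_embed charFq palpha genK x'J
    (y := y + (map_poly J (q + z%:P)).[x]).
  rewrite (artin_schreierD charL) (pullback_equation genL).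
  rewrite -horner_exp -hornerN -hornerD -hornerD -/J.
  rewrite -rmorphXn -rmorphB -rmorphD (artin_schreierD (charKX charFq)) addrA
    qE.
  rewrite -polyC_exp -polyCB zE -alE map_polyZ map_polyXn hornerZ hornerXn.
  rewrite -horner_exp -rmorphXn -hornerZ -map_polyZ; congr ((map_poly _ _).[_]).
  rewrite exprZn scalerA exprVn mulfK ?expf_neq0 //.
  rewrite beE -!mul_polyC [(_ * _ ^+ 2)%:P]polyCM polyC_exp !polyCM polyC_natr
    /f; ring.
exists phi => //.
exact: (range_invariants aV AV VA qV t0 genM phij phiu phiv).
Qed.
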